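(* Let $m\ge n$, let $0<u_h<u$ be two precisions, let $A\in\mathbb{R}^{m\times n}$ have full rank, and let $\widetilde V\in\mathbb{R}^{n\times n}$ satisfy $\|\widetilde V^T\widetilde V-I\|_2\le p_1u<1/2$. Let $\widetilde A=A\widetilde V$, let $\widetilde A_{\mathrm{comp}}$ be its computed counterpart, and let $\widehat v_k(A)$, $k=1,\dots,n$, be the right singular vectors of $A$ computed by the mixed-precision preconditioned one-sided Jacobi algorithm described in the context. Let $\gamma_h=\frac{nu_h}{1-nu_h}<\gamma=\frac{nu}{1-nu}<1$. Assume that 1. $6nu(1-p_1u)^{-1}\kappa_2(A)<1$; 2. $\gamma_h<\dfrac{(1-p_1u)u}{4(1+p_1u)\kappa_2(A)}$; 3. $4\sqrt m\,u<1$ and $16m\sqrt n\,u\,\kappa_2^D(\widetilde A)<1$; 4. the singular values of $A$, of $\widetilde A$ and of $\widetilde A_{\mathrm{comp}}$ are simple; 5. $p_3u\,\kappa_2^D(\widetilde A)\le\min\Big\{\tfrac16,\ \min_{1\le k\le n}\tfrac{\operatorname{svrg}(A,k)}{6}\Big\}$, where $p_3=\max\{6p_2+3\sqrt{mn},\ p_1+p_2+p_1p_2u\}$. Then there is a constant $p_4$ depending only on $m,n,p_1,p_2$ (and not on $A$, $\widetilde V$, $u$, $u_h$ or $k$) such that, for every $k=1,\dots,n$, $$\sin\angle\big(v_k(A),\widehat v_k(A)\big)\le p_4u\left(1+\frac{\kappa_2^D(\widetilde A)}{\operatorname{svrg}(A,k)}\right).$$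
   Context: **Notation.** $\sigma_1(B)\ge\sigma_2(B)\ge\cdots$ are the singular values of $B$, and $v_k(B)$ is an exact (unit) right singular vector of $B$ associated with its $k$th largest singular value. $\kappa_2(B)=\sigma_{\max}(B)/\sigma_{\min}(B)$. For $B$ with nonzero columns $b_i$, $\kappa_2^D(B)=\kappa_2(BD)$ with $D=\operatorname{diag}(\|b_i\|_2^{-1})$. The relative gap is $$\operatorname{svrg}(A,k)=\min\Big\{2,\ \min_{j\ne k}\frac{|\sigma_k(A)-\sigma_j(A)|}{\sigma_k(A)}\Big\}.$$ For nonzero vectors, $\angle(x,y)=\arccos\big(|x^Ty|/(\|x\|_2\|y\|_2)\big)\in[0,\pi/2]$. **Floating point.** ''At precision $w$'' means arithmetic in the standard model with unit roundoff $w$: each elementary operation satisfies $\mathrm{fl}(x\,\mathrm{op}\,y)=(x\,\mathrm{op}\,y)(1+\delta)$ with $|\delta|\le w$, and rounding (demoting) a number to precision $w$ incurs a relative error of at most $w$; no overflow or underflow occurs. **Algorithm** (mixed-precision preconditioned one-sided Jacobi). Input: full-rank $A\in\mathbb{R}^{m\times n}$ with $m\ge n$, precisions $0<u_h<u$, and a preconditioner $\widetilde V$ with $\|\widetilde V^T\widetilde V-I\|_2\le p_1u<1/2$. 1. Compute the product $A\widetilde V$ at precision $u_h$, and demote the computed result to precision $u$; this gives $\widetilde A_{\mathrm{comp}}$. (The exact product is $\widetilde A=A\widetilde V$.) 2. Compute at precision $u$ an SVD $\widetilde A_{\mathrm{comp}}^T=\widehat V_J\widehat\Sigma_J\widehat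 U_J^T$ by the one-sided Jacobi algorithm ($\widehat V_J\in\mathbb{R}^{n\times n}$, $\widehat\Sigma_J\in\mathbb{R}^{n\times n}$ diagonal with nonincreasing diagonal, $\widehat U_J\in\mathbb{R}^{m\times n}$). 3. Form the right singular vector matrix $\widetilde V\widehat V_J$ at precision $u$. Let $\widehat v_k(\widetilde A_{\mathrm{comp}})$ be the $k$th column of $\widehat V_J$ (the computed right singular vector of $\widetilde A_{\mathrm{comp}}$ associated with its $k$th largest computed singular value). The computed $k$th right singular vector of $A$ is $\widehat v_k(A)=\mathrm{fl}\big(\widetilde V\,\widehat v_k(\widetilde A_{\mathrm{comp}})\big)$, i.e. the matrix–vector product formed at precision $u$. **The constant $p_2$.** $p_2$ is the constant in the known backward error result for the one-sided Jacobi algorithm (run with its stopping criterion) used in step 2: there exist $\Delta\widehat U_J,\Delta\widehat V_J,E_L,E_R$ with $$(I+E_L)\widetilde A_{\mathrm{comp}}(I+E_R)=(\widehat U_J+\Delta\widehat U_J)\widehat\Sigma_J(\widehat V_J+\Delta\widehat V_J)^T,$$ $$\|E_L\|_2\le p_2u\,\kappa_2^D(\widetilde A_{\mathrm{comp}}),\qquad \|E_R\|_2,\ \|\Delta\widehat U_J\|_2,\ \|\Delta\widehat V_J\|_2\le p_2u,$$ where $\widehat U_J+\Delta\widehat U_J$ and $\widehat V_J+\Delta\widehat V_J$ are orthogonal (have orthonormal columns). *)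

(* Defs.v *)
From HB Require Import structures.
From mathcomp Require Import all_boot all_order all_algebra.
From mathcomp Require Import complex.
From mathcomp Require Import boolp classical_sets reals trigo.

Set Implicit Arguments.
Unset Strict Implicit.
Unset Printing Implicit Defensive.

Import Order.TTheory GRing.Theory Num.Theory.
Local Open Scope ring_scope.
Local Open Scope classical_set_scope.

Definition vnorm2 (R : realType) n (x : 'cV[R]_n) : R :=
  Num.sqrt (\sum_i x i 0 ^+ 2).

Definition opnorm2 (R : realType) m n (B : 'M[R]_(m, n)) : R :=
  sup [set vnorm2 (B *m x) | x in [set x | vnorm2 x <= 1]].

Definition angle (R : realType) n (x y : 'cV[R]_n) : R :=
  acos (`|(x^T *m y) 0 0| / (vnorm2 x * vnorm2 y)).

(* The squares of the s_i are the eigenvalues of B^T B, counted with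
   algebraic multiplicity. The list has n entries, which is the usual
   convention for m >= n. *)
Definition is_singular_values (R : realType) m n (B : 'M[R]_(m, n))
    (s : seq R) : Prop :=
  [/\ sorted >=%R s, all (>= 0) s &
      char_poly (B^T *m B) = \prod_(x <- s) ('X - (x ^+ 2)%:P)].

Lemma char_poly_simP (F : fieldType) n (P A D : 'M[F]_n) :
  P \in unitmx -> A = invmx P *m D *m P -> char_poly A = char_poly D.
Proof.
move=> uP ->; rewrite /char_poly /char_poly_mx.
set p := map_mx polyC P; set q := map_mx polyC (invmx P).
have qp : q *m p = 1%:M by rewrite -map_mxM mulVmx // map_mx1.
have -> : 'X%:M - map_mx polyC (invmx P *m D *m P)
   = q *m ('X%:M - map_mx polyC D) *m p.
  rewrite mulmxBr mulmxBl -!map_mxM; congr (_ - _).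
  by rewrite scalar_mxC -mulmxA qp mulmx1.
by rewrite !det_mulmx mulrAC -det_mulmx qp det1 mul1r.
Qed.

Lemma singular_values_exist (R : realType) m n (B : 'M[R]_(m, n)) :
  exists s, is_singular_values B s.
Proof.
pose A := B^T *m B.
pose C := [the numClosedFieldType of R[i]].
pose f := real_complex R.
pose AC : 'M[C]_n := map_mx f A.
have ACreal : AC \is a realmx.
  by apply/mxOverP => i j; rewrite mxE; apply/complex_realP; eexists.
have ACsym : AC \is symmetricmx.
  apply/is_hermitianmxP; rewrite expr0 scale1r map_mx_id //.
  by rewrite /AC map_trmx trmx_mul trmxK.
have ACherm := realsym_hermsym ACsym ACreal.
have /hermitian_normalmx/orthomx_spectralP E := ACherm.
have dreal := hermitian_spectral_diag_real ACherm.
have Pu : spectralmx AC \in unitmx by exact: (unitarymx_unit (spectral_unitarymx _)).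
pose d := [seq complex.Re (spectral_diag AC 0 i) | i : 'I_n].
have Ed : char_poly A = \prod_(x <- d) ('X - x%:P).
  apply: (map_poly_inj f).
  rewrite (map_char_poly f) (char_poly_simP Pu E) char_poly_trig; last first.
    exact: (diag_mx_is_trig).
  rewrite rmorph_prod /= /d big_image /=; apply: eq_bigr => i _.
  rewrite rmorphB /= map_polyX map_polyC /= mxE eqxx mulr1n.
  congr (_ - _%:P).
  by rewrite -[LHS]RRe_real //; exact: (mxOverP dreal).
have dpos x : x \in d -> 0 <= x.
  move=> xd; have : root (char_poly A) x by rewrite Ed root_prod_XsubC.
  rewrite -eigenvalue_root_char => /eigenvalueP[v vE v0].
  have sq k (w : 'rV[R]_k) : (w *m w^T) 0 0 = \sum_i w 0 i ^+ 2.
    by rewrite mxE; apply: eq_bigr => i _; rewrite mxE expr2.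
  have h : x * (v *m v^T) 0 0 = (v *m B^T *m (v *m B^T)^T) 0 0.
    have -> : v *m B^T *m (v *m B^T)^T = x *: (v *m v^T).
      by rewrite trmx_mul trmxK mulmxA -(mulmxA v) vE scalemxAl.
    by rewrite [RHS]mxE.
  have vpos : 0 < (v *m v^T) 0 0.
    rewrite sq lt_neqAle sumr_ge0 ?andbT; last by move=> *; rewrite sqr_ge0.
    apply/eqP => /esym/eqP; rewrite psumr_eq0; last by move=> *; rewrite sqr_ge0.
    move=> /allP vz; case/eqP: v0; apply/rowP => i; rewrite mxE.
    by apply/eqP; have := vz i (mem_index_enum _); rewrite /= sqrf_eq0.
  rewrite -(pmulr_lge0 _ vpos) h sq.
  by apply: sumr_ge0 => *; rewrite sqr_ge0.
exists (sort >=%R [seq Num.sqrt x | x <- d]); split.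
- by apply: sort_sorted => x y; exact: le_total.
- by rewrite all_sort; apply/allP => _ /mapP[x _ ->]; rewrite /= sqrtr_ge0.
- rewrite Ed (perm_big _ (permEl (perm_sort _ _))) /= big_map.
  rewrite big_seq [RHS]big_seq; apply: eq_bigr => x /dpos x0.
  by rewrite sqr_sqrtr.
Qed.

Definition singular_values (R : realType) m n (B : 'M[R]_(m, n)) : seq R :=
  sval (cid (singular_values_exist B)).

Lemma singular_valuesP (R : realType) m n (B : 'M[R]_(m, n)) :
  is_singular_values B (singular_values B).
Proof. exact: (svalP (cid (singular_values_exist B))). Qed.

Lemma is_singular_values_inj (R : realType) m n (B : 'M[R]_(m, n)) s t :
  is_singular_values B s -> is_singular_values B t -> s = t.
Proof.
move=> [ss s0 sE] [ts t0 tE].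
apply: (sorted_eq (leT := >=%R)) => //.
- by move=> x y z /= h1 h2; exact: le_trans h2 h1.
- by move=> x y /=; rewrite andbC; exact: le_anti.
have : perm_eq [seq x ^+ 2 | x <- s] [seq x ^+ 2 | x <- t].
  by apply: prod_XsubC_eq; rewrite !big_map -sE -tE.
move=> /(perm_map Num.sqrt); rewrite -!map_comp.
have K r : all (>= 0) r -> [seq (Num.sqrt \o (fun x : R => x ^+ 2)) x | x <- r] = r.
  by move=> /allP h; rewrite -[RHS]map_id; apply/eq_in_map => x /h /= x0;
     rewrite sqrtr_sqr ger0_norm.
by rewrite !K.
Qed.

Lemma size_singular_values (R : realType) m n (B : 'M[R]_(m, n)) :
  size (singular_values B) = n.
Proof.
have [_ _ h] := singular_valuesP B.
by have := size_char_poly (B^T *m B); rewrite h size_prod_XsubC => -[].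
Qed.

(* Zero-based: sigma B 0 is the largest singular value. *)
Definition sigma (R : realType) m n (B : 'M[R]_(m, n)) (k : nat) : R :=
  (singular_values B)`_k.

Definition right_singular_vector (R : realType) m n (B : 'M[R]_(m, n))
    (k : nat) (v : 'cV[R]_n) : Prop :=
  vnorm2 v = 1 /\
  exists w : 'cV[R]_m,
    [/\ vnorm2 w = 1, B *m v = sigma B k *: w & B^T *m w = sigma B k *: v].

Definition kappa2 (R : realType) m n (B : 'M[R]_(m, n)) : R :=
  sigma B 0 / sigma B n.-1.

Definition kappa2D (R : realType) m n (B : 'M[R]_(m, n)) : R :=
  kappa2 (B *m diag_mx (\row_j (vnorm2 (col j B))^-1)).

Definition svrg (R : realType) m n (B : 'M[R]_(m, n)) (k : 'I_n) : R :=
  \big[Num.min/2]_(j < n | j != k) (`|sigma B k - sigma B j| / sigma B k).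

(* Rounding in the standard model: y is a possible computed value of x at
   unit roundoff w. *)
Definition fl_round (R : realType) (w x y : R) : Prop :=
  exists2 d : R, `|d| <= w & y = x * (1 + d).

(* z is a possible computed value of the sum of the list s, the additions
   being carried out in an arbitrary order. *)
Inductive fl_sum (R : realType) (w : R) : seq R -> R -> Prop :=
| fl_sum1 x : fl_sum w [:: x] x
| fl_sumD s s1 s2 z1 z2 z :
    perm_eq s (s1 ++ s2) -> fl_sum w s1 z1 -> fl_sum w s2 z2 ->
    fl_round w (z1 + z2) z -> fl_sum w s z.

Definition fl_dot (R : realType) (w : R) n (a : 'rV[R]_n) (b : 'cV[R]_n)
    (z : R) : Prop :=
  exists2 p : 'I_n -> R,
    forall i, fl_round w (a 0 i * b i 0) (p i) & fl_sum w [seq p i | i : 'I_n] z.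

Definition fl_mulmx (R : realType) (w : R) m n q (B : 'M[R]_(m, n))
    (C : 'M[R]_(n, q)) (P : 'M[R]_(m, q)) : Prop :=
  forall i j, fl_dot w (row i B) (col j C) (P i j).

Definition fl_demote (R : realType) (w : R) m n (B P : 'M[R]_(m, n)) : Prop :=
  forall i j, fl_round w (B i j) (P i j).

(* U diag(s) V^T is a computed SVD of B at precision u satisfying the backward
   error bounds of the one-sided Jacobi algorithm with constant p2. *)
Definition jacobi_svd (R : realType) (p2 u : R) m n (B : 'M[R]_(m, n))
    (U : 'M[R]_(m, n)) (s : 'rV[R]_n) (V : 'M[R]_n) : Prop :=
  [/\ forall i, 0 <= s 0 i,
      forall i j : 'I_n, (i <= j)%N -> s 0 j <= s 0 i &
      exists (EL : 'M[R]_m) (ER : 'M[R]_n) (dU : 'M[R]_(m, n)) (dV : 'M[R]_n),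
      [/\ (1%:M + EL) *m B *m (1%:M + ER) =
            (U + dU) *m diag_mx s *m (V + dV)^T,
          (U + dU)^T *m (U + dU) = 1%:M /\ (V + dV)^T *m (V + dV) = 1%:M,
          opnorm2 EL <= p2 * u * kappa2D B &
          [/\ opnorm2 ER <= p2 * u, opnorm2 dU <= p2 * u &
              opnorm2 dV <= p2 * u]]].

(* A run of the mixed-precision preconditioned one-sided Jacobi algorithm on
   A with preconditioner V: Acomp is the demoted computed product, and the
   columns of W are the computed right singular vectors of A. *)
Definition mp_jacobi_run (R : realType) (p2 uh u : R) m n (A : 'M[R]_(m, n))
    (V : 'M[R]_n) (Acomp : 'M[R]_(m, n)) (W : 'M[R]_n) : Prop :=
  exists (P : 'M[R]_(m, n)) (U : 'M[R]_(m, n)) (s : 'rV[R]_n) (VJ : 'M[R]_n),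
  [/\ fl_mulmx uh A V P, fl_demote u P Acomp, jacobi_svd p2 u Acomp U s VJ &
      fl_mulmx u V VJ W].

Definition gam (R : realType) (n : nat) (w : R) : R :=
  n%:R * w / (1 - n%:R * w).

(* Main.v *)
Require Import Defs.
From mathcomp Require Import all_boot all_order all_algebra.
From mathcomp Require Import reals trigo.
From mathcomp Require Import ring lra.

Set Implicit Arguments.
Unset Strict Implicit.
Unset Printing Implicit Defensive.

Import Order.TTheory GRing.Theory Num.Theory.
Local Open Scope ring_scope.

(** The computed singular vectors are, up to small errors, obtained from an
    exact singular value decomposition of a two-sided multiplicative
    perturbation [G = M *m A *m N] of [A].

    The rounding errors made in [A V] are small relative to each column
    ([demoted_product_error]): a column [A V_j] can be smaller than
    [|A| |V_j|] by no more than the factor [kappa2 A], which the higher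
    precision pays for.  A perturbation relative to the columns is a left factor
    [1 + E1] with [E1] of size [u kappa2D (A V)], because column norms cancel
    ([columnwise_perturbation]).  The same reasoning shows that [kappa2D] of
    the computed product is at most [4 n] times that of [A V]
    ([kappa2D_perturbed]), so that the left backward error of the Jacobi
    algorithm has this size as well.  Hence [M] differs from the identity by
    [O(u kappa2D (A V))], while [N = V (1 + ER)] has a Gram matrix within
    [O(u)] of the identity.

    Multiplicative perturbations preserve singular values up to a relative
    error, by a Courant-Fischer argument ([singular_comparison]), and rotate
    singular vectors by an angle controlled by the relative gap
    ([perturbed_singular_vector]).  The vector that is compared with [v_k (A)]
    is [N q], where [q] is the [k]-th right singular vector of [G]; the
    computed vector [W_k] differs from it by [O(u)]
    ([computed_vector_error]).

    The perturbation argument needs the perturbation to be a small fraction of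
    the relative gap.  This costs nothing: when [u kappa2D (A V)] is not small
    compared with the gap, the claimed bound is at least 1 for a suitable
    constant, and a sine is at most 1.  Norm bounds are not sharp in [n], since
    only the dependence on the dimensions alone matters. *)

(** * Euclidean norm and operator bounds *)

Definition dot (R : realType) n (x y : 'cV[R]_n) : R := (x^T *m y) 0 0.

Lemma dotE (R : realType) n (x y : 'cV[R]_n) : dot x y = \sum_i x i 0 * y i 0.
Proof. by rewrite /dot mxE; apply: eq_bigr => i _; rewrite mxE. Qed.

Lemma dotC (R : realType) n (x y : 'cV[R]_n) : dot x y = dot y x.
Proof. by rewrite !dotE; apply: eq_bigr => i _; rewrite mulrC. Qed.

Lemma dotDr (R : realType) n (x y z : 'cV[R]_n) :
  dot x (y + z) = dot x y + dot x z.
Proof. by rewrite /dot mulmxDr mxE. Qed.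

Lemma dotZr (R : realType) n a (x y : 'cV[R]_n) : dot x (a *: y) = a * dot x y.
Proof. by rewrite /dot -scalemxAr mxE. Qed.

Lemma dotNr (R : realType) n (x y : 'cV[R]_n) : dot x (- y) = - dot x y.
Proof. by rewrite /dot mulmxN mxE. Qed.

Lemma dotBr (R : realType) n (x y z : 'cV[R]_n) :
  dot x (y - z) = dot x y - dot x z.
Proof. by rewrite dotDr dotNr. Qed.

Lemma dotDl (R : realType) n (x y z : 'cV[R]_n) :
  dot (x + y) z = dot x z + dot y z.
Proof. by rewrite dotC dotDr !(dotC z). Qed.

Lemma dotBl (R : realType) n (x y z : 'cV[R]_n) :
  dot (x - y) z = dot x z - dot y z.
Proof. by rewrite dotC dotBr !(dotC z). Qed.

Lemma dotZl (R : realType) n a (x y : 'cV[R]_n) : dot (a *: x) y = a * dot x y.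
Proof. by rewrite dotC dotZr dotC. Qed.

Lemma dot_mulmxr (R : realType) m n (B : 'M[R]_(m, n)) x y :
  dot x (B *m y) = dot (B^T *m x) y.
Proof. by rewrite /dot trmx_mul trmxK mulmxA. Qed.

Lemma dot_mulmxl (R : realType) m n (B : 'M[R]_(m, n)) x y :
  dot (B *m x) y = dot x (B^T *m y).
Proof. by rewrite dotC dot_mulmxr dotC. Qed.

Lemma vnorm2_ge0 (R : realType) n (x : 'cV[R]_n) : 0 <= vnorm2 x.
Proof. exact: sqrtr_ge0. Qed.
#[local] Hint Extern 0 (is_true (0 <= vnorm2 _)) => exact: vnorm2_ge0 : core.

Lemma dotxx (R : realType) n (x : 'cV[R]_n) : dot x x = vnorm2 x ^+ 2.
Proof.
rewrite sqr_sqrtr; last by apply: sumr_ge0 => i _; rewrite sqr_ge0.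
by rewrite dotE; apply: eq_bigr => i _; rewrite expr2.
Qed.

Lemma vnorm2_sqr (R : realType) n (x : 'cV[R]_n) :
  vnorm2 x ^+ 2 = \sum_i x i 0 ^+ 2.
Proof. by rewrite -dotxx dotE; apply: eq_bigr => i _; rewrite expr2. Qed.

Lemma vnorm2_eq0 (R : realType) n (x : 'cV[R]_n) : vnorm2 x = 0 -> x = 0.
Proof.
move=> x0; have /eqP := vnorm2_sqr x; rewrite x0 expr0n /= eq_sym.
rewrite psumr_eq0; last by move=> i _; rewrite sqr_ge0.
move=> /allP h; apply/colP => i; rewrite mxE; apply/eqP.
by have := h i (mem_index_enum _); rewrite /= sqrf_eq0.
Qed.

Lemma vnorm2_gt0 (R : realType) n (x : 'cV[R]_n) : x != 0 -> 0 < vnorm2 x.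
Proof.
by move=> x0; rewrite lt_def vnorm2_ge0 andbT; apply: contraNneq x0 => /vnorm2_eq0 ->.
Qed.

Lemma vnorm2_le_sqr (R : realType) n (x : 'cV[R]_n) (c : R) :
  0 <= c -> vnorm2 x ^+ 2 <= c ^+ 2 -> vnorm2 x <= c.
Proof. by move=> c0; rewrite ler_sqr ?nnegrE. Qed.

Lemma vnorm2Z (R : realType) n a (x : 'cV[R]_n) : vnorm2 (a *: x) = `|a| * vnorm2 x.
Proof.
apply/eqP; rewrite -(@eqrXn2 _ 2 (vnorm2 _)) ?mulr_ge0 //; apply/eqP.
by rewrite exprMn -!dotxx dotZl dotZr mulrA -expr2 real_normK ?num_real.
Qed.

Lemma vnorm2N (R : realType) n (x : 'cV[R]_n) : vnorm2 (- x) = vnorm2 x.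
Proof. by rewrite -scaleN1r vnorm2Z normrN1 mul1r. Qed.

Lemma vnorm20 (R : realType) n : vnorm2 (0 : 'cV[R]_n) = 0.
Proof. by rewrite -(scale0r 0) vnorm2Z normr0 mul0r. Qed.

Lemma normr_dot_le (R : realType) n (x y : 'cV[R]_n) :
  `|dot x y| <= vnorm2 x * vnorm2 y.
Proof.
have [->|y0] := eqVneq y 0.
  by rewrite -(scale0r 0) dotZr mul0r normr0 mulr_ge0.
have ny := vnorm2_gt0 y0.
rewrite -ler_sqr ?nnegrE ?mulr_ge0 // real_normK ?num_real // exprMn.
have : 0 <= dot (vnorm2 y ^+ 2 *: x - dot x y *: y) (vnorm2 y ^+ 2 *: x - dot x y *: y).
  by rewrite dotxx sqr_ge0.
rewrite dotBr !dotBl !(dotZr, dotZl) (dotC y x) !dotxx => h.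
rewrite -(ler_pM2l (exprn_gt0 2 ny)); nra.
Qed.

Lemma ler_vnorm2D (R : realType) n (x y : 'cV[R]_n) :
  vnorm2 (x + y) <= vnorm2 x + vnorm2 y.
Proof.
apply: vnorm2_le_sqr; first exact: addr_ge0.
rewrite -dotxx dotDr !dotDl !dotxx (dotC y x).
have := le_trans (ler_norm _) (normr_dot_le x y); nra.
Qed.

Lemma ler_vnorm2B (R : realType) n (x y : 'cV[R]_n) :
  vnorm2 (x - y) <= vnorm2 x + vnorm2 y.
Proof. by rewrite (le_trans (ler_vnorm2D _ _)) // vnorm2N. Qed.

Lemma lerB_vnorm2D (R : realType) n (x y : 'cV[R]_n) :
  vnorm2 x - vnorm2 y <= vnorm2 (x + y).
Proof. by rewrite lerBlDr -{1}(addrK y x) ler_vnorm2B. Qed.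

Lemma ler_vnorm2 (R : realType) n (x y : 'cV[R]_n) :
  (forall i, `|x i 0| <= `|y i 0|) -> vnorm2 x <= vnorm2 y.
Proof.
move=> xy; apply: vnorm2_le_sqr => //; rewrite !vnorm2_sqr; apply: ler_sum => i _.
by rewrite -(real_normK (num_real (x i 0))) -(real_normK (num_real (y i 0))) ler_sqr.
Qed.

Lemma vnorm2_abs (R : realType) n (x : 'cV[R]_n) :
  vnorm2 (map_mx Num.norm x) = vnorm2 x.
Proof. by apply: le_anti; rewrite !ler_vnorm2 // => i; rewrite mxE normr_id. Qed.

Lemma normr_coord_le (R : realType) n (x : 'cV[R]_n) i : `|x i 0| <= vnorm2 x.
Proof.
rewrite -ler_sqr ?nnegrE // real_normK ?num_real // vnorm2_sqr (bigD1 i) //=.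
by rewrite lerDl; apply: sumr_ge0 => j _; rewrite sqr_ge0.
Qed.

Lemma ler_vnorm2_sum (R : realType) n (I : Type) (r : seq I) (F : I -> 'cV[R]_n) :
  vnorm2 (\sum_(i <- r) F i) <= \sum_(i <- r) vnorm2 (F i).
Proof.
elim: r => [|i r IH]; first by rewrite !big_nil vnorm20.
by rewrite !big_cons (le_trans (ler_vnorm2D _ _)) // lerD2l.
Qed.

(** A bound on every vector instead of a supremum, so that bounds on sums,
    products and transposes are obtained by applying them in turn. *)
Definition opbound (R : realType) m n (c : R) (B : 'M[R]_(m, n)) : Prop :=
  forall x, vnorm2 (B *m x) <= c * vnorm2 x.

Lemma opboundW (R : realType) m n c d (B : 'M[R]_(m, n)) :
  c <= d -> opbound c B -> opbound d B.
Proof. by move=> cd h x; rewrite (le_trans (h x)) // ler_wpM2r. Qed.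

Lemma opbound1 (R : realType) n : opbound 1 (1%:M : 'M[R]_n).
Proof. by move=> x; rewrite mul1mx mul1r. Qed.

Lemma opboundD (R : realType) m n c d (B C : 'M[R]_(m, n)) :
  opbound c B -> opbound d C -> opbound (c + d) (B + C).
Proof.
move=> hB hC x; rewrite mulmxDl (le_trans (ler_vnorm2D _ _)) // mulrDl.
by rewrite lerD.
Qed.

Lemma opboundM (R : realType) m n q c d (B : 'M[R]_(m, n)) (C : 'M[R]_(n, q)) :
  0 <= c -> opbound c B -> opbound d C -> opbound (c * d) (B *m C).
Proof.
move=> c0 hB hC x; rewrite -mulmxA (le_trans (hB _)) // -mulrA ler_wpM2l //.
Qed.

(** By Cauchy-Schwarz applied to [|B^T y|^2 = <B (B^T y), y>]. *)
Lemma opbound_tr (R : realType) m n c (B : 'M[R]_(m, n)) :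
  0 <= c -> opbound c B -> opbound c B^T.
Proof.
move=> c0 hB y; have [e0|z0] := eqVneq (B^T *m y) 0.
  by rewrite e0 vnorm20 mulr_ge0.
rewrite -(ler_pM2l (vnorm2_gt0 z0)) -expr2 -dotxx -dot_mulmxr.
rewrite mulmxA dotC -mulmxA (le_trans (ler_norm _)) //.
rewrite (le_trans (normr_dot_le _ _)) // mulrA [_ * c]mulrC.
by rewrite ler_wpM2r.
Qed.

Lemma mulmx_sum_col (R : realType) m n (B : 'M[R]_(m, n)) x :
  B *m x = \sum_j x j 0 *: col j B.
Proof.
apply/colP => i; rewrite mxE summxE; apply: eq_bigr => j _.
by rewrite !mxE mulrC.
Qed.

(** The factor [n] in place of the sharp [Num.sqrt n] comes from bounding the
    l1 norm of [x] by [n] times its largest entry; only the dependence on [n]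
    alone matters. *)
Lemma opbound_col (R : realType) m n c (B : 'M[R]_(m, n)) :
  (forall j, vnorm2 (col j B) <= c) -> opbound (n%:R * c) B.
Proof.
move=> hB x; rewrite mulmx_sum_col (le_trans (ler_vnorm2_sum _ _)) //.
rewrite -mulrA mulr_natl -[X in _ *+ X]card_ord -sumr_const.
apply: ler_sum => j _; rewrite vnorm2Z mulrC ler_pM //.
exact: normr_coord_le.
Qed.

Lemma vnorm2_delta (R : realType) n (j : 'I_n) :
  vnorm2 (delta_mx j 0 : 'cV[R]_n) = 1.
Proof.
rewrite -[LHS]ger0_norm // -[LHS]sqrtr_sqr vnorm2_sqr (bigD1 j) //=.
rewrite big1 => [|i ij]; first by rewrite mxE !eqxx addr0 expr1n sqrtr1.
by rewrite mxE (negbTE ij) expr0n.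
Qed.

Lemma vnorm2_col_le (R : realType) m n c (B : 'M[R]_(m, n)) j :
  opbound c B -> vnorm2 (col j B) <= c.
Proof.
move=> h; rewrite -[col j B]/(_) colE (le_trans (h _)) //.
by rewrite vnorm2_delta mulr1.
Qed.

Lemma opbound_abs (R : realType) m n c (B : 'M[R]_(m, n)) :
  opbound c B -> opbound (n%:R * c) (map_mx Num.norm B).
Proof.
by move=> h; apply: opbound_col => j; rewrite -map_col vnorm2_abs vnorm2_col_le.
Qed.

(** The supremum defining [opnorm2] is informative because the column norms
    bound the set it is taken over; it is evaluated at the normalized [x]. *)
Lemma opbound_opnorm2 (R : realType) m n c (B : 'M[R]_(m, n)) :
  opnorm2 B <= c -> opbound c B.
Proof.
move=> hc x; have [->|x0] := eqVneq x 0; first by rewrite mulmx0 !vnorm20 mulr0.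
have nx := vnorm2_gt0 x0.
have -> : x = vnorm2 x *: ((vnorm2 x)^-1 *: x).
  by rewrite scalerA divff ?gt_eqF // scale1r.
set y := (vnorm2 x)^-1 *: x.
have ny : vnorm2 y = 1.
  by rewrite vnorm2Z ger0_norm ?invr_ge0 // mulVf // gt_eqF.
rewrite -scalemxAr 2!vnorm2Z ny mulr1 mulrC ler_wpM2r //.
apply: le_trans hc; rewrite /opnorm2; apply: ub_le_sup; last first.
  by exists y => //=; rewrite ny.
have hb : opbound (n%:R * \sum_j vnorm2 (col j B)) B.
  apply: opbound_col => j; rewrite (bigD1 j) //= lerDl.
  by apply: sumr_ge0.
exists (n%:R * \sum_j vnorm2 (col j B)) => _ [z /= z1 <-].
rewrite (le_trans (hb z)) // ler_piMr // mulr_ge0 //.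
by apply: sumr_ge0.
Qed.

Lemma opnorm2_ge0 (R : realType) m n (B : 'M[R]_(m, n)) c :
  opnorm2 B <= c -> (0 < n)%N -> 0 <= c.
Proof.
move=> /opbound_opnorm2 h n0; apply: le_trans (vnorm2_col_le (Ordinal n0) h).
exact: vnorm2_ge0.
Qed.

(** * The real spectral theorem and singular bases *)

Lemma vnorm2_orthomx (R : realType) m n (Q : 'M[R]_(m, n)) x :
  Q^T *m Q = 1%:M -> vnorm2 (Q *m x) = vnorm2 x.
Proof.
move=> QQ; apply/eqP; rewrite -(@eqrXn2 _ 2) //; apply/eqP.
by rewrite -!dotxx dot_mulmxr mulmxA QQ mul1mx.
Qed.

(** A Householder reflection: for [w = e_0 - v] the reflection in the
    hyperplane orthogonal to [w] exchanges [e_0] and [v]. *)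
Lemma householder (R : realType) n (v : 'cV[R]_n.+1) :
  vnorm2 v = 1 ->
  exists2 H : 'M[R]_n.+1, H^T *m H = 1%:M & H *m delta_mx 0 0 = v.
Proof.
move=> v1; set e : 'cV[R]_n.+1 := delta_mx 0 0.
have e1 : vnorm2 e = 1 by exact: vnorm2_delta.
have [ev|] := eqVneq (e - v) 0.
  exists 1%:M; first by rewrite trmx1 mul1mx.
  by rewrite mul1mx; apply/eqP; rewrite -subr_eq0 ev.
set w := e - v => w0; have nw := vnorm2_gt0 w0.
pose c := 2 / vnorm2 w ^+ 2.
have cw : c * vnorm2 w ^+ 2 = 2 by rewrite divfK // expf_eq0 gt_eqF.
have ww k (B : 'M_(1, k)) : w *m w^T *m (w *m B) = vnorm2 w ^+ 2 *: (w *m B).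
  rewrite mulmxA -(mulmxA w) [w^T *m w]mx11_scalar -/(dot w w) dotxx.
  by rewrite mul_mx_scalar -scalemxAl.
exists (1%:M - c *: (w *m w^T)).
  have -> : (1%:M - c *: (w *m w^T))^T = 1%:M - c *: (w *m w^T).
    by rewrite [LHS]raddfB /= trmx1 [X in _ - X]linearZ /= trmx_mul trmxK.
  rewrite mulmxBl mul1mx mulmxBr mulmx1.
  rewrite -scalemxAl -scalemxAr ww !scalerA -mulrA cw.
  by apply/matrixP => i j; rewrite !mxE; ring.
have we : dot w e = vnorm2 w ^+ 2 / 2.
  rewrite -dotxx /w !(dotBl, dotBr) !dotxx v1 e1 (dotC e v); lra.
rewrite mulmxBl mul1mx -scalemxAl -mulmxA [w^T *m e]mx11_scalar -/(dot w e) we.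
rewrite mul_mx_scalar scalerA mulrA cw divff ?pnatr_eq0 // scale1r.
by rewrite /w opprB addrC subrK.
Qed.

Lemma orthomx_unit (R : realType) n (Q : 'M[R]_n) : Q^T *m Q = 1%:M -> Q \in unitmx.
Proof. by case/mulmx1_unit. Qed.

(** Deflation: a root of the characteristic polynomial gives a real unit
    eigenvector, and a Householder reflection moves it to the first axis and
    leaves a smaller symmetric block. *)
Lemma real_spectral (R : realType) n (S : 'M[R]_n) (s : seq R) :
  S^T = S -> char_poly S = \prod_(x <- s) ('X - x%:P) ->
  exists2 Q : 'M[R]_n,
    Q^T *m Q = 1%:M & Q^T *m S *m Q = diag_mx (\row_j s`_j).
Proof.
elim: n S s => [|n IH] S s symS cS.
  by exists 1%:M; apply/matrixP => - [].
case: s cS => [|a s] cS.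
  by have := size_char_poly S; rewrite cS big_nil size_polyC oner_eq0.
have : eigenvalue S a.
  by rewrite eigenvalue_root_char cS root_prod_XsubC mem_head.
case/eigenvalueP=> r rS r0.
have [v v1 Sv] : exists2 v, vnorm2 v = 1 & S *m v = a *: v.
  have rT0 : r^T != 0 by rewrite trmx_eq0.
  have nr := vnorm2_gt0 rT0.
  exists ((vnorm2 r^T)^-1 *: r^T).
    by rewrite vnorm2Z ger0_norm ?invr_ge0 // mulVf // gt_eqF.
  rewrite -scalemxAr -{1}symS -trmx_mul rS linearZ /= !scalerA.
  by rewrite mulrC.
have [H HH He] := householder v1.
have uH := orthomx_unit HH.
have iH : invmx H = H^T by rewrite -[LHS]mul1mx -HH -mulmxA mulmxV // mulmx1.
have [T defT] : {T : 'M[R]_n.+1 | T = H^T *m S *m H} by eexists.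
have symT : T^T = T by rewrite defT !trmx_mul trmxK symS mulmxA.
have Te : T *m delta_mx 0 0 = a *: (delta_mx 0 0 : 'cV_n.+1).
  rewrite defT -!mulmxA He Sv -scalemxAr -He mulmxA HH mul1mx //.
have T0 (i : 'I_n.+1) : T i 0 = a * (i == 0)%:R.
  have := congr1 (fun M : 'cV_n.+1 => M i 0) Te.
  by rewrite -colE !mxE eqxx andbT.
pose S' : 'M[R]_n := drsubmx (T : 'M_(1 + n)).
have l0 : lshift n (0 : 'I_1) = (0 : 'I_n.+1) by apply: val_inj.
have TE : (T : 'M_(1 + n)) = block_mx a%:M 0 0 S'.
  rewrite -[LHS](@submxK _ 1 n 1 n T); congr block_mx.
  - apply/matrixP => i j; rewrite !ord1 !mxE eqxx mulr1n.
    by rewrite l0 (T0 0) eqxx mulr1.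
  - apply/matrixP => i j; rewrite !ord1 !mxE -[T in LHS]symT mxE.
    by rewrite l0 (T0 (rshift 1 j)) mulr0.
  - apply/matrixP => i j; rewrite !ord1 !mxE.
    by rewrite l0 (T0 (rshift 1 i)) mulr0.
have symS' : S'^T = S' by rewrite /S' trmx_drsub symT.
have cS' : char_poly S' = \prod_(x <- s) ('X - x%:P).
  have cT : char_poly T = char_poly S.
    apply/esym/(@char_poly_simP _ _ (invmx H)); first by rewrite unitmx_inv.
    by rewrite invmxK defT iH -!mulmxA -iH mulmxV // mulmx1 mulmxA mulmxV // mul1mx.
  have cB : char_poly (block_mx a%:M 0 0 S' : 'M_(1 + n)) = ('X - a%:P) * char_poly S'.
    by rewrite /char_poly char_block_diag_mx det_ublock det_mx11 !mxE eqxx !mulr1n.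
  move: cT; rewrite cS big_cons -[char_poly T]/(@char_poly _ (1 + n) T) TE cB.
  by apply: mulfI; rewrite polyXsubC_eq0.
have [Q QQ QS] := IH _ _ symS' cS'.
pose L : 'M_(1 + n) := block_mx 1%:M 0 0 Q.
have LL : L^T *m L = 1%:M.
  rewrite tr_block_mx mulmx_block !trmx0 trmx1 !(mulmx0, mul0mx, addr0, add0r).
  by rewrite mul1mx QQ -scalar_mx_block.
exists ((H : 'M_(1 + n)) *m L).
  by rewrite trmx_mul -mulmxA (mulmxA H^T) HH mul1mx.
rewrite trmx_mul.
have -> : L^T *m H^T *m S *m (H *m L) = L^T *m T *m L by rewrite defT !mulmxA.
rewrite -[LHS]/((L^T : 'M_(1 + n)) *m (T : 'M_(1 + n)) *m L) TE.
rewrite tr_block_mx !mulmx_block !trmx0 trmx1 !(mulmx0, mul0mx, addr0, add0r).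
rewrite mul1mx mulmx1 QS.
rewrite -[a%:M]diag_const_mx -diag_mx_row; congr diag_mx.
apply/rowP => j; rewrite !mxE.
by case: (@splitP 1 n j) => k ->; rewrite !mxE ?ord1.
Qed.

Lemma orthomxC (R : realType) n (Q : 'M[R]_n) : Q^T *m Q = 1%:M -> Q *m Q^T = 1%:M.
Proof. exact: mulmx1C. Qed.

(** Right singular vectors together with their singular values.  Left singular
    vectors are left out: the arguments below only use [B^T B], and where [d]
    vanishes they would have to be chosen. *)
Definition singular_basis (R : realType) m n (B : 'M[R]_(m, n)) (d : 'rV[R]_n)
    (Q : 'M[R]_n) : Prop :=
  Q^T *m Q = 1%:M /\
  Q^T *m (B^T *m B) *m Q = diag_mx (\row_j (d 0 j ^+ 2)).

Lemma sigma_ge0 (R : realType) m n (B : 'M[R]_(m, n)) i : 0 <= sigma B i.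
Proof.
have [_ /allP h _] := singular_valuesP B; rewrite /sigma.
have [i_lt|i_ge] := ltnP i (size (singular_values B)).
  exact/h/mem_nth.
by rewrite nth_default.
Qed.

Lemma sigma_anti (R : realType) m n (B : 'M[R]_(m, n)) i j :
  (i <= j < n)%N -> sigma B j <= sigma B i.
Proof.
case/andP=> ij jn; have [h _ _] := singular_valuesP B.
have tr : transitive (>=%R : rel R) by move=> x y z /= h1 h2; exact: le_trans h2 h1.
have rf : reflexive (>=%R : rel R) by move=> x /=.
by apply: (sorted_leq_nth tr rf 0 h); rewrite // inE size_singular_values // (leq_ltn_trans ij).
Qed.

Lemma singular_basis_exists (R : realType) m n (B : 'M[R]_(m, n)) :
  exists Q, singular_basis B (\row_j sigma B j) Q.
Proof.
have [_ _ h] := singular_valuesP B.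
have sym : (B^T *m B)^T = B^T *m B by rewrite trmx_mul trmxK.
have h' : char_poly (B^T *m B) =
    \prod_(x <- [seq x ^+ 2 | x <- singular_values B]) ('X - x%:P).
  by rewrite h big_map.
have [Q QQ QB] := real_spectral sym h'; exists Q; split=> //.
rewrite QB; congr diag_mx; apply/rowP => j; rewrite !mxE (nth_map 0) //.
by rewrite size_singular_values.
Qed.

Lemma singular_basis_svd (R : realType) m n (U : 'M[R]_(m, n)) d (Q : 'M[R]_n) :
  U^T *m U = 1%:M -> Q^T *m Q = 1%:M ->
  singular_basis (U *m diag_mx d *m Q^T) d Q.
Proof.
move=> UU QQ; split=> //.
rewrite !trmx_mul trmxK tr_diag_mx.
have -> : Q^T *m (Q *m (diag_mx d *m U^T) *m (U *m diag_mx d *m Q^T)) *m Q =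
    (Q^T *m Q) *m diag_mx d *m (U^T *m U) *m diag_mx d *m (Q^T *m Q).
  by rewrite !mulmxA.
by rewrite UU QQ !mulmx1 mul1mx mulmx_diag; congr diag_mx; apply/rowP => j; rewrite !mxE expr2.
Qed.

Lemma singular_basis_eigen (R : realType) m n (B : 'M[R]_(m, n)) d Q j :
  singular_basis B d Q ->
  B^T *m (B *m col j Q) = d 0 j ^+ 2 *: col j Q.
Proof.
case=> QQ QB.
have BQ : B^T *m B *m Q = Q *m diag_mx (\row_j (d 0 j ^+ 2)).
  by rewrite -QB !mulmxA (orthomxC QQ) mul1mx.
have := congr1 (col j) BQ; rewrite [col j _]colE -!mulmxA -colE => ->.
by apply/colP => i; rewrite mul_mx_diag !mxE mulrC.
Qed.

Lemma vnorm2_coord (R : realType) n (Q : 'M[R]_n) x :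
  Q^T *m Q = 1%:M -> vnorm2 (Q^T *m x) = vnorm2 x.
Proof. by move=> QQ; rewrite vnorm2_orthomx // trmxK orthomxC. Qed.

Lemma vnorm2_singular_basis (R : realType) m n (B : 'M[R]_(m, n)) d Q x :
  singular_basis B d Q ->
  vnorm2 (B *m x) ^+ 2 = \sum_j (d 0 j * (Q^T *m x) j 0) ^+ 2.
Proof.
case=> QQ QB; rewrite -dotxx dot_mulmxr.
have -> : B^T *m (B *m x) = Q *m (diag_mx (\row_j (d 0 j ^+ 2)) *m (Q^T *m x)).
  by rewrite -QB !mulmxA (orthomxC QQ) mul1mx -!mulmxA (mulmxA Q Q^T) (orthomxC QQ) mul1mx.
rewrite dot_mulmxl dotE; apply: eq_bigr => j _.
by rewrite mul_diag_mx [X in X * _]mxE mxE; ring.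
Qed.

(** The span of some of the singular directions is described by the support of
    the coordinates [Q^T *m x]. *)
Lemma vnorm2_singular_le (R : realType) m n (B : 'M[R]_(m, n)) d Q x c :
  singular_basis B d Q -> 0 <= c ->
  (forall j, (Q^T *m x) j 0 != 0 -> `|d 0 j| <= c) ->
  vnorm2 (B *m x) <= c * vnorm2 x.
Proof.
move=> sB c0 h; have [QQ _] := sB.
apply: vnorm2_le_sqr; first exact: mulr_ge0.
rewrite (vnorm2_singular_basis _ sB) -(vnorm2_coord x QQ) exprMn vnorm2_sqr.
rewrite mulr_sumr; apply: ler_sum => j _; rewrite exprMn.
have [->|nz] := eqVneq ((Q^T *m x) j 0) 0; first by rewrite expr0n !mulr0.
rewrite ler_wpM2r ?sqr_ge0 // -(real_normK (num_real (d 0 j))) ler_sqr ?nnegrE //.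
exact: h.
Qed.

Lemma vnorm2_singular_ge (R : realType) m n (B : 'M[R]_(m, n)) d Q x c :
  singular_basis B d Q -> 0 <= c ->
  (forall j, (Q^T *m x) j 0 != 0 -> c <= d 0 j) ->
  c * vnorm2 x <= vnorm2 (B *m x).
Proof.
move=> sB c0 h; have [QQ _] := sB.
rewrite -ler_sqr ?nnegrE ?mulr_ge0 //.
rewrite (vnorm2_singular_basis _ sB) -(vnorm2_coord x QQ) exprMn vnorm2_sqr.
rewrite mulr_sumr; apply: ler_sum => j _; rewrite exprMn.
have [->|nz] := eqVneq ((Q^T *m x) j 0) 0; first by rewrite expr0n !mulr0.
by rewrite ler_wpM2r ?sqr_ge0 // ler_sqr ?nnegrE ?h // (le_trans c0) // h.
Qed.

Lemma sigma_max (R : realType) m n (B : 'M[R]_(m, n)) : opbound (sigma B 0) B.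
Proof.
have [Q sB] := singular_basis_exists B => x.
apply: (vnorm2_singular_le sB) => [|j _]; first exact: sigma_ge0.
by rewrite mxE ger0_norm ?sigma_ge0 // sigma_anti // leq0n ltn_ord.
Qed.

Lemma sigma_min (R : realType) m n (B : 'M[R]_(m, n)) x :
  sigma B n.-1 * vnorm2 x <= vnorm2 (B *m x).
Proof.
have [Q sB] := singular_basis_exists B.
apply: (vnorm2_singular_ge sB) => [|j _]; first exact: sigma_ge0.
by rewrite mxE sigma_anti //; case: n j {B x Q sB} => [[]|n] //= j; rewrite -ltnS ltn_ord /=.
Qed.

Lemma sigma_attained (R : realType) m n (B : 'M[R]_(m, n)) i :
  (i < n)%N -> exists2 x, vnorm2 x = 1 & vnorm2 (B *m x) = sigma B i.
Proof.
move=> ltin; have [Q sB] := singular_basis_exists B; have [QQ _] := sB.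
pose j := Ordinal ltin; exists (col j Q).
  by rewrite colE vnorm2_orthomx // vnorm2_delta.
apply/eqP; rewrite -(@eqrXn2 _ 2) ?sigma_ge0 //; apply/eqP.
rewrite (vnorm2_singular_basis _ sB) colE mulmxA QQ mul1mx (bigD1 j) //=.
rewrite big1 ?addr0 => [|l lj]; first by rewrite !mxE !eqxx mulr1.
by rewrite !mxE (negbTE lj) mulr0 expr0n.
Qed.

Lemma sigma_min_gt0 (R : realType) m n (B : 'M[R]_(m, n)) :
  (0 < n)%N -> (forall x : 'cV[R]_n, B *m x = 0 -> x = 0) -> 0 < sigma B n.-1.
Proof.
move=> n0 inj; have ltn : (n.-1 < n)%N by rewrite prednK.
have [x x1 <-] := sigma_attained B ltn.
apply: vnorm2_gt0; apply: contra_eq_neq x1 => /inj ->.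
by rewrite vnorm20 eq_sym oner_eq0.
Qed.

Lemma kappa2_ge1 (R : realType) m n (B : 'M[R]_(m, n)) :
  (0 < n)%N -> (forall x : 'cV[R]_n, B *m x = 0 -> x = 0) -> 1 <= kappa2 B.
Proof.
move=> n0 inj; rewrite /kappa2 ler_pdivlMr ?sigma_min_gt0 // mul1r.
by rewrite sigma_anti //= prednK.
Qed.

(** There are [k] equations and [k + 1] free entries: the square matrix that
    collects the equations and the vanishing entries has a zero row. *)
Lemma exists_supported_kernel (R : realType) n (K : 'M[R]_n) (k : 'I_n) :
  exists2 c : 'cV[R]_n, c != 0 &
    (forall j : 'I_n, (k < j)%N -> c j 0 = 0) /\
    (forall i : 'I_n, (i < k)%N -> (K *m c) i 0 = 0).
Proof.
pose L : 'M[R]_n := \matrix_(i, j)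
  if (i < k)%N then K i j else if (k < i)%N then (i == j)%:R else 0.
have : \det L^T == 0.
  rewrite det_tr (expand_det_row _ k) big1 // => j _.
  by rewrite mxE !ltnn mul0r.
case/det0P=> r r0 rL; have Lc : L *m r^T = 0 by rewrite -[L]trmxK -trmx_mul rL trmx0.
exists r^T; first by rewrite trmx_eq0.
split=> i ki; have := congr1 (fun M : 'cV_n => M i 0) Lc; rewrite !mxE.
- rewrite (bigD1 i) //= big1 ?addr0 => [|j ji].
    by rewrite !mxE ltnNge ltnW //= ki eqxx mul1r.
  by rewrite !mxE ltnNge ltnW //= ki eq_sym (negbTE ji) mul0r.
- by move=> h; apply: etrans h; apply: eq_bigr => j _; rewrite !mxE ki.
Qed.

(** Multiplicative form of the Courant-Fischer comparison: the span of the
    singular directions of [G] of index at most [k], of dimension [k + 1], meets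
    the preimage under [N] of the span of those of [B] of index at least [k],
    of dimension at least [n - k].  A common vector compares [s_k] and [d_k]. *)
Lemma singular_comparison (R : realType) m m' n (B : 'M[R]_(m, n)) d Q
    (G : 'M[R]_(m', n)) s Q' (N : 'M[R]_n) (b c : R) (k : 'I_n) :
  singular_basis B d Q -> singular_basis G s Q' ->
  (forall i j : 'I_n, (i <= j)%N -> d 0 j <= d 0 i) ->
  (forall i j : 'I_n, (i <= j)%N -> s 0 j <= s 0 i) ->
  (forall i, 0 <= d 0 i) -> (forall i, 0 <= s 0 i) ->
  0 <= c -> opbound b N ->
  (forall y, vnorm2 (G *m y) <= c * vnorm2 (B *m (N *m y))) ->
  s 0 k <= c * b * d 0 k.
Proof.
move=> sB sG dA sA d0 s0 c0 bN GB; have [QQ _] := sB; have [QQ' _] := sG.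
have [z z0 [zs zk]] := exists_supported_kernel (Q^T *m N *m Q') k.
pose y := Q' *m z.
have ny : 0 < vnorm2 y by rewrite vnorm2_orthomx // vnorm2_gt0.
have lo : s 0 k * vnorm2 y <= vnorm2 (G *m y).
  apply: (vnorm2_singular_ge sG) => // j.
  rewrite mulmxA QQ' mul1mx => zj; apply: sA; rewrite leqNgt.
  by apply: contra zj => /zs ->.
have hi : vnorm2 (B *m (N *m y)) <= d 0 k * vnorm2 (N *m y).
  apply: (vnorm2_singular_le sB) => // j.
  rewrite !mulmxA => zj; rewrite ger0_norm //; apply: dA; rewrite leqNgt.
  by apply: contra zj => /zk ->.
rewrite -(ler_pM2r ny) (le_trans lo) // (le_trans (GB y)) //.
rewrite -!mulrA ler_wpM2l // (le_trans hi) // mulrCA ler_wpM2l //.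
Qed.

(** * Rounding errors of matrix products *)

(** Each entry of a sum of [size s] numbers takes part in at most
    [(size s).-1] additions, whatever their order. *)
Lemma fl_sum_error (R : realType) (w : R) s z :
  0 <= w -> fl_sum w s z ->
  (0 < size s)%N /\
  `|z - \sum_(x <- s) x| <= ((1 + w) ^+ (size s).-1 - 1) * \sum_(x <- s) `|x|.
Proof.
move=> w0; elim=> {s z} [x|s s1 s2 z1 z2 z sE _ [n1 IH1] _ [n2 IH2] [d dw ->]].
  by rewrite !big_seq1 subrr normr0 /= expr0 subrr mul0r.
have sz : size s = (size s1 + size s2)%N by rewrite (perm_size sE) size_cat.
split; first by rewrite sz addn_gt0 n1.
have ew a b : (a <= b)%N -> (1 + w) ^+ a <= (1 + w) ^+ b.
  by move=> ab; rewrite ler_weXn2l // lerDl.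
rewrite !(perm_big _ sE) !big_cat /=.
set S1 := \sum_(x <- s1) x in IH1 *; set S2 := \sum_(x <- s2) x in IH2 *.
set T1 := \sum_(x <- s1) `|x| in IH1 *; set T2 := \sum_(x <- s2) `|x| in IH2 *.
have S1T : `|S1| <= T1 by exact: ler_norm_sum.
have S2T : `|S2| <= T2 by exact: ler_norm_sum.
pose e := (1 + w) ^+ (size s).-2.
have eE : (1 + w) ^+ (size s).-1 = (1 + w) * e.
  rewrite /e -exprS prednK // sz -ltnS prednK ?addn_gt0 ?n1 //.
  by rewrite -[2%N]/(1 + 1)%N leq_add.
have T10 : 0 <= T1 by rewrite (le_trans _ S1T).
have T20 : 0 <= T2 by rewrite (le_trans _ S2T).
have {}IH1 : `|z1 - S1| <= (e - 1) * T1.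
  rewrite (le_trans IH1) // ler_wpM2r // lerB // ew // sz.
  by rewrite -(prednK n1) -(prednK n2) addSn addnS /= leq_addr.
have {}IH2 : `|z2 - S2| <= (e - 1) * T2.
  rewrite (le_trans IH2) // ler_wpM2r // lerB // ew // sz.
  by rewrite -(prednK n1) -(prednK n2) addSn addnS /= leq_addl.
have -> : (z1 + z2) * (1 + d) - (S1 + S2) =
    ((z1 - S1) + (z2 - S2)) * (1 + d) + (S1 + S2) * d by ring.
rewrite eE (le_trans (ler_normD _ _)) // !normrM.
have d1 : `|1 + d| <= 1 + w by rewrite (le_trans (ler_normD _ _)) // normr1 lerD2l.
have h1 : `|z1 - S1 + (z2 - S2)| <= (e - 1) * T1 + (e - 1) * T2.
  by rewrite (le_trans (ler_normD _ _)) // lerD.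
have h2 : `|S1 + S2| <= T1 + T2 by rewrite (le_trans (ler_normD _ _)) // lerD.
rewrite (le_trans (lerD (ler_pM _ _ h1 d1) (ler_pM _ _ h2 dw))) //.
by rewrite le_eqVlt; apply/orP; left; apply/eqP; ring.
Qed.

(** Equivalently [(1 + w)^n (1 - n w) <= 1], by induction from
    [(1 + w) (1 - (n + 1) w) <= 1 - n w]. *)
Lemma expr_le_gam (R : realType) n (w : R) :
  0 <= w -> n%:R * w < 1 -> (1 + w) ^+ n - 1 <= gam n w.
Proof.
move=> w0 nw; have p : 0 < 1 - n%:R * w by rewrite subr_gt0.
rewrite /gam ler_pdivlMr // mulrBl mul1r lerBlDr addrCA subrr addr0.
elim: n {nw p} => [|n IH]; first by rewrite expr0 mul0r subr0 mul1r.
rewrite (le_trans _ IH) // exprSr -mulrA ler_wpM2l //.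
  by rewrite exprn_ge0 // addr_ge0.
have n0 : 0 <= n%:R :> R by []; rewrite -natr1; nra.
Qed.

Lemma gam_ge0 (R : realType) n (w : R) : 0 <= w -> n%:R * w < 1 -> 0 <= gam n w.
Proof.
by move=> w0 nw; rewrite /gam divr_ge0 ?mulr_ge0 // subr_ge0 ltW.
Qed.

Lemma fl_dot_error (R : realType) (w : R) n (a : 'rV[R]_n) (b : 'cV[R]_n) z :
  0 <= w -> n%:R * w < 1 -> fl_dot w a b z ->
  `|z - (a *m b) 0 0| <= gam n w * (map_mx Num.norm a *m map_mx Num.norm b) 0 0.
Proof.
move=> w0 nw [p pE /(fl_sum_error w0)[]].
rewrite size_map -cardE card_ord !big_image /= => n0 zE.
set T := (X in _ <= _ * X).
have TE : T = \sum_i `|a 0 i * b i 0|.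
  by rewrite /T mxE; apply: eq_bigr => i _; rewrite !mxE normrM.
have T0 : 0 <= T by rewrite TE; apply: sumr_ge0.
have hp : \sum_i `|p i| <= (1 + w) * T.
  rewrite TE mulr_sumr; apply: ler_sum => i _; have [d dw ->] := pE i.
  rewrite normrM mulrC ler_wpM2r // (le_trans (ler_normD _ _)) //.
  by rewrite normr1 lerD2l.
have hs : `|\sum_i p i - (a *m b) 0 0| <= w * T.
  rewrite mxE -sumrB (le_trans (ler_norm_sum _ _ _)) // TE mulr_sumr.
  apply: ler_sum => i _; have [d dw ->] := pE i.
  by rewrite mulrDr mulr1 addrC addKr normrM mulrC ler_wpM2r.
have := expr_le_gam w0 nw; rewrite -{1}(prednK n0) exprS.
set e := (1 + w) ^+ n.-1 in zE *; set g := gam n w => eg.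
have e1 : 1 <= e by rewrite exprn_ege1 // lerDl.
rewrite -(subrK (\sum_i p i) z) -addrA (le_trans (ler_normD _ _)) //.
have e0 : 0 <= e - 1 by rewrite subr_ge0.
have := ler_wpM2l e0 hp; have := ler_wpM2r T0 eg; lra.
Qed.

(** The entrywise error is bounded by the product of the absolute values, whose
    norm exceeds that of [B] by a factor of at most [n]. *)
Lemma fl_mulmx_col_error (R : realType) (w c : R) m n q (B : 'M[R]_(m, n))
    (C : 'M[R]_(n, q)) P j :
  0 <= w -> n%:R * w < 1 -> opbound c B -> fl_mulmx w B C P ->
  vnorm2 (col j P - B *m col j C) <= gam n w * (n%:R * c) * vnorm2 (col j C).
Proof.
move=> w0 nw bB flP; have g0 := gam_ge0 w0 nw.
have -> : gam n w * (n%:R * c) * vnorm2 (col j C) =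
    gam n w * (n%:R * c * vnorm2 (map_mx Num.norm (col j C))).
  by rewrite vnorm2_abs -[LHS]mulrA.
apply: le_trans (ler_wpM2l g0 (opbound_abs bB _)).
rewrite -[X in X * _](ger0_norm g0) -vnorm2Z; apply: ler_vnorm2 => i.
have := fl_dot_error w0 nw (flP i j).
have -> : (row i B *m col j C) 0 0 = (B *m col j C) i 0.
  by rewrite !mxE; apply: eq_bigr => l _; rewrite !mxE.
have -> : (map_mx Num.norm (row i B) *m map_mx Num.norm (col j C)) 0 0 =
    (map_mx Num.norm B *m map_mx Num.norm (col j C)) i 0.
  by rewrite !mxE; apply: eq_bigr => l _; rewrite !mxE.
set x := map_mx _ B *m _ => h.
have -> : (col j P - B *m col j C) i 0 = P i j - (B *m col j C) i 0.
  by rewrite !mxE.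
apply: le_trans h _; rewrite [(_ *: x) i 0]mxE normrM ger0_norm //.
by rewrite ler_wpM2l // ler_norm.
Qed.

(** * Perturbation of singular vectors under two-sided multiplication *)

Lemma coordE (R : realType) n (Q : 'M[R]_n) (x : 'cV[R]_n) j :
  (Q^T *m x) j 0 = dot (col j Q) x.
Proof. by rewrite dotE mxE; apply: eq_bigr => i _; rewrite !mxE. Qed.

Lemma near_id_bounds (R : realType) n (M : 'M[R]_n) e y :
  opbound e (M - 1%:M) ->
  (1 - e) * vnorm2 y <= vnorm2 (M *m y) <= (1 + e) * vnorm2 y.
Proof.
move=> h; have -> : M *m y = y + (M - 1%:M) *m y by rewrite mulmxBl mul1mx addrC subrK.
have := h y; have := lerB_vnorm2D y ((M - 1%:M) *m y).
have := ler_vnorm2D y ((M - 1%:M) *m y); lra.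
Qed.

Lemma near_id_gram (R : realType) n (M : 'M[R]_n) e :
  0 <= e <= 1 -> opbound e (M - 1%:M) -> opbound (3 * e) (M^T *m M - 1%:M).
Proof.
move=> /andP[e0 e1] h; have hT := opbound_tr e0 h.
have -> : M^T *m M - 1%:M =
    (M - 1%:M)^T *m (M - 1%:M) + ((M - 1%:M)^T + (M - 1%:M)).
  rewrite [(M - 1%:M)^T]raddfB /= trmx1 !(mulmxBl, mulmxBr) !(mul1mx, mulmx1).
  by apply/matrixP => i j; rewrite !mxE; ring.
apply: opboundW (opboundD (opboundM e0 hT h) (opboundD hT h)).
by nra.
Qed.

(** From [|N y|^2 - |y|^2 = <y, (N^T N - 1) y>]. *)
Lemma gram_bounds (R : realType) m n (N : 'M[R]_(m, n)) e y :
  0 <= e <= 1 -> opbound e (N^T *m N - 1%:M) ->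
  (1 - e) * vnorm2 y <= vnorm2 (N *m y) <= (1 + e) * vnorm2 y.
Proof.
move=> /andP[e0 e1] h.
have nN : vnorm2 (N *m y) ^+ 2 = vnorm2 y ^+ 2 + dot y ((N^T *m N - 1%:M) *m y).
  rewrite mulmxBl mul1mx dotBr -!dotxx dot_mulmxl mulmxA; ring.
have := normr_dot_le y ((N^T *m N - 1%:M) *m y); rewrite ler_norml.
set t := dot _ _ in nN * => /andP[t1 t2].
have h1 := ler_wpM2l (vnorm2_ge0 y) (h y).
have y0 := vnorm2_ge0 y; have z0 := vnorm2_ge0 (N *m y).
apply/andP; split.
  by rewrite -ler_sqr ?nnegrE ?mulr_ge0 ?subr_ge0 // nN; nra.
by apply: vnorm2_le_sqr; [rewrite mulr_ge0 ?addr_ge0 | rewrite nN; nra].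
Qed.

Lemma unitmx_injective (R : realType) n (N : 'M[R]_n) :
  (forall x : 'cV[R]_n, N *m x = 0 -> x = 0) -> N \in unitmx.
Proof.
move=> inj; rewrite -unitmx_tr unitmxE unitfE; apply/det0P => - [r r0 rN].
case/eqP: r0; apply: trmx_inj; rewrite trmx0; apply: inj.
by rewrite -[N]trmxK -trmx_mul rN trmx0.
Qed.

Lemma gram_unitmx (R : realType) n (N : 'M[R]_n) e :
  0 <= e < 1 -> opbound e (N^T *m N - 1%:M) ->
  N \in unitmx /\ opbound (1 - e)^-1 (invmx N).
Proof.
move=> /andP[e0 e1] h; have p : 0 < 1 - e by rewrite subr_gt0.
have low y : (1 - e) * vnorm2 y <= vnorm2 (N *m y).
  have e01 : 0 <= e <= 1 by rewrite e0 ltW.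
  by have /andP[] := gram_bounds y e01 h.
have uN : N \in unitmx.
  apply: unitmx_injective => x Nx; apply: vnorm2_eq0; apply/le_anti.
  by rewrite vnorm2_ge0 andbT -(pmulr_rle0 _ p) (le_trans (low x)) // Nx vnorm20.
split=> // y; rewrite ler_pdivlMl // (le_trans (low _)) // mulmxA mulmxV // mul1mx //.
Qed.

Lemma vnorm2_mul_singular (R : realType) m n (B : 'M[R]_(m, n)) d Q j :
  singular_basis B d Q -> vnorm2 (B *m col j Q) = `|d 0 j|.
Proof.
move=> sB; have [QQ _] := sB; apply/eqP; rewrite -(@eqrXn2 _ 2) //; apply/eqP.
rewrite -dotxx dot_mulmxl (singular_basis_eigen _ sB) dotZr dotxx.
rewrite colE vnorm2_orthomx // vnorm2_delta expr1n mulr1.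
by rewrite real_normK ?num_real.
Qed.

(** The upper bound compares [G] with [A] through [N], the lower bound compares
    [A] with [G] through the inverse of [N]. *)
Lemma perturbed_singular_value (R : realType) m n
    (A G : 'M[R]_(m, n)) (M : 'M[R]_m) (N Q Q' : 'M[R]_n) (d s : 'rV[R]_n)
    (eta eps : R) (k : 'I_n) :
  G = M *m A *m N -> singular_basis A d Q -> singular_basis G s Q' ->
  (forall i j : 'I_n, (i <= j)%N -> d 0 j <= d 0 i) ->
  (forall i j : 'I_n, (i <= j)%N -> s 0 j <= s 0 i) ->
  (forall i, 0 <= d 0 i) -> (forall i, 0 <= s 0 i) ->
  0 <= eta <= 1 / 2 -> 0 <= eps <= 1 / 2 ->
  opbound eta (M - 1%:M) -> opbound eps (N^T *m N - 1%:M) ->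
  `|s 0 k - d 0 k| <= 2 * (eta + eps) * d 0 k.
Proof.
move=> GE sA sG d_anti s_anti d_ge0 s_ge0 /andP[eta0 eta1] /andP[eps0 eps1] etaM epsN.
have eps01 : 0 <= eps < 1 by rewrite eps0; lra.
have [uN bN] := gram_unitmx eps01 epsN.
have up : s 0 k <= (1 + eta) * (1 + eps) * d 0 k.
  apply: (singular_comparison (N := N) k sA sG) => //; first by lra.
    have eps01' : 0 <= eps <= 1 by rewrite eps0; lra.
    by move=> y; have /andP[] := gram_bounds y eps01' epsN.
  by move=> y; rewrite GE -!mulmxA; have /andP[] := near_id_bounds (A *m (N *m y)) etaM.
have p : 0 < 1 - eta by lra.
have q : 0 < 1 - eps by lra.
have lo : d 0 k <= (1 - eta)^-1 * (1 - eps)^-1 * s 0 k.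
  apply: (singular_comparison (N := invmx N) k sG sA) (bN) _ => //.
    by rewrite invr_ge0 ltW.
  move=> y; rewrite ler_pdivlMl // GE -!mulmxA (mulmxA N) mulmxV // mul1mx.
  by have /andP[] := near_id_bounds (A *m y) etaM.
have {}lo : (1 - eta) * (1 - eps) * d 0 k <= s 0 k.
  by rewrite -ler_pdivlMl ?mulr_gt0 // invfM.
have h1 : 0 <= eta * eps * d 0 k by rewrite !mulr_ge0.
have h2 : eta * (eps * d 0 k) <= 1 / 2 * (eps * d 0 k) by rewrite ler_wpM2r ?mulr_ge0.
have h3 : 0 <= eta * d 0 k by rewrite mulr_ge0.
have h4 : 0 <= eps * d 0 k by rewrite mulr_ge0.
by rewrite ler_norml; apply/andP; split; lra.
Qed.

(** With [q] the perturbed right singular vector and [x = N q], the eigenvector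
    equation for [G^T G] reads [A^T M^T M A x = s^2 N^-T q], where the right
    hand side is [s^2 x] up to a relative error [eps].  Testing it against
    the [j]-th singular vector of [A] isolates [(d_j^2 - s^2) x_j], and every
    remainder carries a factor [s (s + d_j)]: dividing by
    [d_j^2 - s^2 = (d_j - s) (d_j + s)] leaves the relative gap alone. *)
Lemma perturbed_singular_vector (R : realType) m n
    (A G : 'M[R]_(m, n)) (M : 'M[R]_m) (N Q Q' : 'M[R]_n) (d s : 'rV[R]_n)
    (eta eps rho : R) (k : 'I_n) :
  G = M *m A *m N -> singular_basis A d Q -> singular_basis G s Q' ->
  (forall i j : 'I_n, (i <= j)%N -> d 0 j <= d 0 i) ->
  (forall i j : 'I_n, (i <= j)%N -> s 0 j <= s 0 i) ->
  (forall i, 0 <= d 0 i) -> (forall i, 0 <= s 0 i) ->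
  0 <= eta -> 0 <= eps  ->
  opbound eta (M - 1%:M) -> opbound eps (N^T *m N - 1%:M) ->
  rho <= 2 -> eta + eps <= rho / 8 -> 0 < d 0 k ->
  (forall j : 'I_n, j != k -> rho * d 0 k <= `|d 0 k - d 0 j|) ->
  forall j : 'I_n, j != k ->
  rho * `|(Q^T *m (N *m col k Q')) j 0| <= 24 * (eta + eps).
Proof.
move=> GE sA sG d_anti s_anti d_ge0 s_ge0 eta0 eps0 etaM epsN rho2 small dk_gt0 gap j jk.
have eta_le : 0 <= eta <= 1 / 2 by rewrite eta0; lra.
have eps_le : 0 <= eps <= 1 / 2 by rewrite eps0; lra.
have eps01 : 0 <= eps < 1 by rewrite eps0; lra.
have [uN bN] := gram_unitmx eps01 epsN.
 set q := col k Q'; set x := N *m q; rewrite coordE.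
set vj := col j Q; set xj := dot vj x; set sk := s 0 k; set dk := d 0 k; set dj := d 0 j.
have q1 : vnorm2 q = 1 by rewrite /q colE vnorm2_orthomx ?vnorm2_delta //; case: sG.
have vj1 : vnorm2 vj = 1 by rewrite /vj colE vnorm2_orthomx ?vnorm2_delta //; case: sA.
have hs : `|sk - dk| <= 2 * (eta + eps) * dk 
  by exact: (perturbed_singular_value k GE sA sG).
(* [g] is the difference between [N^-T q] and [x]. *)
pose g := (invmx N)^T *m (q - N^T *m N *m q).
have gb : vnorm2 g <= 2 * eps.
  have p : 0 < 1 - eps by lra.
  have p0 : 0 <= (1 - eps)^-1 by rewrite invr_ge0 ltW.
  rewrite (le_trans (opbound_tr p0 bN _)) // -vnorm2N opprB.
  have -> : N^T *m N *m q - q = (N^T *m N - 1%:M) *m q by rewrite mulmxBl mul1mx.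
  rewrite ler_pdivrMl // (le_trans (epsN q)) // q1; nra.
have main : A^T *m (M^T *m M *m (A *m x)) = sk ^+ 2 *: (x + g).
  have := singular_basis_eigen k sG; rewrite -/q -/sk => e.
  have -> : x + g = (invmx N)^T *m q.
    rewrite /g mulmxBr -!mulmxA (mulmxA (invmx N)^T) -(trmx_mul N) mulmxV // trmx1 mul1mx.
    by rewrite addrC subrK.
  rewrite scalemxAr -e GE !trmx_mul /x -!mulmxA (mulmxA (invmx N)^T).
  by rewrite -(trmx_mul N) mulmxV // trmx1 mul1mx.
pose r := dot (A *m vj) ((M^T *m M - 1%:M) *m (A *m x)).
have eqn : (dj ^+ 2 - sk ^+ 2) * xj = sk ^+ 2 * dot vj g - r.
  have := congr1 (dot vj) main; rewrite dotZr dotDr -/xj dot_mulmxr trmxK.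
  have -> : M^T *m M *m (A *m x) = A *m x + (M^T *m M - 1%:M) *m (A *m x).
    by rewrite mulmxBl mul1mx addrC subrK.
  rewrite dotDr -/r dot_mulmxr (singular_basis_eigen _ sA) dotZl -/xj -/dj.
  lra.
have Ax : vnorm2 (A *m x) <= 2 * sk.
  have /andP[+ _] := near_id_bounds (A *m x) etaM.
  have -> : M *m (A *m x) = G *m q by rewrite GE /x !mulmxA.
  rewrite (vnorm2_mul_singular _ sG) ger0_norm // -/sk.
  have := vnorm2_ge0 (A *m x); nra.
have gb' : `|dot vj g| <= 2 * eps.
  by rewrite (le_trans (normr_dot_le _ _)) // vj1 mul1r.
have dj0 : 0 <= dj by exact: d_ge0.
have rb : `|r| <= 6 * eta * (dj * sk).
  rewrite (le_trans (normr_dot_le _ _)) // (vnorm2_mul_singular _ sA) ger0_norm //.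
  have hM : opbound (3 * eta) (M^T *m M - 1%:M) by apply: near_id_gram => //; lra.
  have := ler_wpM2l dj0 (le_trans (hM _) (ler_wpM2l (_ : 0 <= 3 * eta) Ax)).
  rewrite -/dj => h; rewrite (le_trans (h _)) //; first lra.
  by rewrite le_eqVlt; apply/orP; left; apply/eqP; ring.
have hdk : 2 * (eta + eps) * dk <= rho / 4 * dk by rewrite ler_pM2r //; lra.
have hdk' : rho / 4 * dk <= 1 / 2 * dk by rewrite ler_pM2r //; lra.
have sk0 : 0 < sk.
  by move: hs; rewrite ler_norml => /andP[] + _; rewrite -/dk in dk_gt0 *; lra.
have step : `|dj - sk| * `|xj| <= sk * (2 * eps + 6 * eta).
  have p : 0 < dj + sk by rewrite ltr_wpDl.
  rewrite -(ler_pM2l p) mulrA -{1}(gtr0_norm p) -normrM -normrM.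
  have -> : (dj + sk) * (dj - sk) * xj = (dj ^+ 2 - sk ^+ 2) * xj by ring.
  rewrite eqn (le_trans (ler_normB _ _)) // normrM ger0_norm ?sqr_ge0 //.
  have h1 := ler_wpM2l (sqr_ge0 sk) gb'.
  have h2 : 0 <= sk ^+ 2 * eta by rewrite mulr_ge0 ?sqr_ge0.
  have h3 : 0 <= dj * sk * eps by rewrite !mulr_ge0 // ltW.
  lra.
have gapj := gap j jk; rewrite -/dk -/dj in gapj.
have tri : `|dk - dj| <= `|dj - sk| + `|sk - dk|.
  by rewrite -[dk - dj]opprB normrN (le_trans _ (ler_normD _ _)) // addrA subrK.
have far : rho * dk / 2 <= `|dj - sk|.
  have : 0 <= (eta + eps) * dk by rewrite mulr_ge0 ?addr_ge0 ?(ltW dk_gt0).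
  lra.
have sk2 : sk <= 2 * dk.
  by move: hs; rewrite ler_norml => /andP[_]; rewrite -/dk in dk_gt0 *; lra.
have x0 : 0 <= `|xj| by [].
rewrite -(ler_pM2l dk_gt0) -/dk.
have h1 := ler_wpM2r x0 far.
have h2 : sk * (2 * eps + 6 * eta) <= 2 * dk * (2 * eps + 6 * eta).
  by rewrite ler_wpM2r //; lra.
have h3 : 0 <= eps * dk by rewrite mulr_ge0 // ltW.
lra.
Qed.

(** * Column scaling *)

(** For the pseudoinverse [P = (B^T B)^-1 B^T] the product [B P] is an orthogonal
    projection, hence [sigma_min |P y| <= |B P y| <= |y|]. *)
Lemma left_inverse_bound (R : realType) m n (B : 'M[R]_(m, n)) :
  (0 < n)%N -> (forall x : 'cV[R]_n, B *m x = 0 -> x = 0) ->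
  exists2 P : 'M[R]_(n, m), P *m B = 1%:M & opbound (sigma B n.-1)^-1 P.
Proof.
move=> n0 inj; have s0 := sigma_min_gt0 n0 inj.
have uB : B^T *m B \in unitmx.
  apply: unitmx_injective => x Bx; apply: inj; apply: vnorm2_eq0.
  apply/eqP; rewrite -sqrf_eq0 -dotxx dot_mulmxl mulmxA Bx.
  by rewrite /dot mulmx0 mxE.
exists (invmx (B^T *m B) *m B^T); first by rewrite -mulmxA mulVmx.
move=> y; set z := _ *m y; rewrite ler_pdivlMl // (le_trans (sigma_min B z)) //.
have Bz : vnorm2 (B *m z) ^+ 2 <= vnorm2 (B *m z) * vnorm2 y.
  have -> : vnorm2 (B *m z) ^+ 2 = dot (B *m z) y.
    rewrite -dotxx dot_mulmxl (dot_mulmxl B z y); congr dot.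
    by rewrite /z !mulmxA mulmxV // mul1mx.
  by rewrite (le_trans (ler_norm _)) // normr_dot_le.
have [->|nz] := eqVneq (vnorm2 (B *m z)) 0; first exact: vnorm2_ge0.
by rewrite -(@ler_pM2l _ (vnorm2 (B *m z))) -?expr2 // lt_def nz vnorm2_ge0.
Qed.

Definition normalize_cols (R : realType) m n (B : 'M[R]_(m, n)) : 'M[R]_(m, n) :=
  B *m diag_mx (\row_j (vnorm2 (col j B))^-1).

Lemma col_normalize_cols (R : realType) m n (B C : 'M[R]_(m, n)) j :
  col j (B *m diag_mx (\row_j (vnorm2 (col j C))^-1)) =
  (vnorm2 (col j C))^-1 *: col j B.
Proof. by apply/colP => i; rewrite mul_mx_diag !mxE mulrC. Qed.

Lemma col_injective_gt0 (R : realType) m n (B : 'M[R]_(m, n)) j :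
  (forall x : 'cV[R]_n, B *m x = 0 -> x = 0) -> 0 < vnorm2 (col j B).
Proof.
move=> inj; apply: vnorm2_gt0; apply/eqP => Bj.
have : vnorm2 (delta_mx j 0 : 'cV[R]_n) = 1 by exact: vnorm2_delta.
rewrite (inj (delta_mx j 0)) ?vnorm20 -?colE // => /eqP.
by rewrite eq_sym oner_eq0.
Qed.

Lemma normalize_cols_injective (R : realType) m n (B : 'M[R]_(m, n)) :
  (forall x : 'cV[R]_n, B *m x = 0 -> x = 0) ->
  (forall x : 'cV[R]_n, normalize_cols B *m x = 0 -> x = 0).
Proof.
move=> inj x; rewrite /normalize_cols -mulmxA => /inj Dx; apply/colP => j.
have := congr1 (fun M : 'cV_n => M j 0) Dx; rewrite mul_diag_mx !mxE => /eqP.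
rewrite mulf_eq0 invr_eq0 gt_eqF ?col_injective_gt0 //=.
by move/eqP.
Qed.

(** A normalized column is the image of a unit vector, so the largest singular
    value of the normalized matrix is at least 1. *)
Lemma invr_sigma_le_kappa2D (R : realType) m n (B : 'M[R]_(m, n)) :
  (0 < n)%N -> (forall x : 'cV[R]_n, B *m x = 0 -> x = 0) ->
  (sigma (normalize_cols B) n.-1)^-1 <= kappa2D B.
Proof.
move=> n0 inj; pose j := Ordinal n0.
have b0 := col_injective_gt0 j inj.
have /(vnorm2_col_le j) := sigma_max (normalize_cols B).
rewrite col_normalize_cols vnorm2Z ger0_norm ?invr_ge0 // mulVf ?gt_eqF // => h.
by rewrite /kappa2D /kappa2 -/(normalize_cols B) ler_peMl // invr_ge0 sigma_ge0.
Qed.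

(** Perturbing each column relative to its own norm is a left multiplicative
    perturbation whose size is governed by the condition number of the matrix
    with normalized columns, since the column norms cancel. *)
Lemma columnwise_perturbation (R : realType) m n (B C : 'M[R]_(m, n))
    (c : R) :
  (0 < n)%N -> (forall x : 'cV[R]_n, B *m x = 0 -> x = 0) -> 0 <= c ->
  (forall j, vnorm2 (col j C - col j B) <= c * vnorm2 (col j B)) ->
  exists2 E : 'M[R]_m, C = (1%:M + E) *m B & opbound (n%:R * c * kappa2D B) E.
Proof.
move=> n0 inj c0 CB.
have [P PB bP] := left_inverse_bound n0 (normalize_cols_injective inj).
pose D : 'M[R]_n := diag_mx (\row_j (vnorm2 (col j B))^-1).
pose F := (C - B) *m D.
have bF : opbound (n%:R * c) F.
  apply: opbound_col => j; rewrite /F /D col_normalize_cols vnorm2Z.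
  rewrite ger0_norm ?invr_ge0 // ler_pdivrMl ?col_injective_gt0 // mulrC.
  by rewrite raddfB; exact: CB.
exists (F *m P).
  have DD : D *m diag_mx (\row_j vnorm2 (col j B)) = 1%:M.
    rewrite /D mulmx_diag; apply/matrixP => i j; rewrite !mxE.
    by rewrite mulVf // gt_eqF // col_injective_gt0.
  have BE : B = normalize_cols B *m diag_mx (\row_j vnorm2 (col j B)).
    by rewrite /normalize_cols -mulmxA DD mulmx1.
  rewrite mulmxDl mul1mx [X in _ + _ *m X]BE -mulmxA (mulmxA P) PB mul1mx.
  by rewrite /F -mulmxA DD mulmx1 addrC subrK.
have nc0 : 0 <= n%:R * c by rewrite mulr_ge0.
apply: opboundW (opboundM nc0 bF bP).
by rewrite ler_wpM2l // invr_sigma_le_kappa2D.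
Qed.

(** Normalized columns bound the largest singular value by [n].  The smallest one
    loses at most a factor 2 through [1 + E] and another factor 2 because the
    columns of the two matrices are divided by different norms. *)
Lemma kappa2D_perturbed (R : realType) m n (B : 'M[R]_(m, n))
    (E : 'M[R]_m) :
  (0 < n)%N -> (forall x : 'cV[R]_n, B *m x = 0 -> x = 0) ->
  opbound (1 / 2) E ->
  kappa2D ((1%:M + E) *m B) <= 4 * n%:R * kappa2D B.
Proof.
move=> n0 inj bE; set C := (1%:M + E) *m B.
have bE' : opbound (1 / 2) (1%:M + E - 1%:M) by rewrite addrC addKr.
have CB y : 1 / 2 * vnorm2 (B *m y) <= vnorm2 (C *m y) <= 2 * vnorm2 (B *m y).
  have /andP[h1 h2] := near_id_bounds (B *m y) bE'.
  have y0 := vnorm2_ge0 (B *m y).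
  by rewrite /C -mulmxA; apply/andP; split; lra.
have b0 j := col_injective_gt0 j inj.
have c0 j : 0 < vnorm2 (col j C).
  have /andP[+ _] := CB (delta_mx j 0); rewrite -!colE.
  by apply: lt_le_trans; rewrite mulr_gt0 ?divr_gt0.
have ltn : (n.-1 < n)%N by rewrite prednK.
have up : sigma (normalize_cols C) 0 <= n%:R.
  have [x x1 <-] := sigma_attained (normalize_cols C) n0.
  rewrite -[n%:R]mulr1 -[X in n%:R * X]mulr1 -[X in _ <= _ * (_ * X)]x1 mulrA.
  move: x {x1}; apply: opbound_col => j.
  by rewrite col_normalize_cols vnorm2Z ger0_norm ?invr_ge0 // mulVf ?gt_eqF.
set s := sigma (normalize_cols B) n.-1.
have s0 : 0 < s by apply: sigma_min_gt0 (normalize_cols_injective inj).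
have lo : s / 4 <= sigma (normalize_cols C) n.-1.
  have [x x1 <-] := sigma_attained (normalize_cols C) ltn.
  pose D : 'M[R]_n := diag_mx (\row_j (vnorm2 (col j C))^-1).
  (* [z] trades the normalization of the columns of [C] for that of [B]. *)
  pose z : 'cV[R]_n := \col_j (vnorm2 (col j B) / vnorm2 (col j C) * x j 0).
  have Dx : B *m (D *m x) = normalize_cols B *m z.
    rewrite /normalize_cols -[RHS]mulmxA; congr (_ *m _); apply/colP => j.
    by rewrite !mul_diag_mx !mxE !mulrA mulVf ?mul1r // gt_eqF.
  have nz : 1 / 2 <= vnorm2 z.
    have <- : vnorm2 (1 / 2 *: x) = 1 / 2 by rewrite vnorm2Z x1 mulr1 ger0_norm ?divr_ge0.
    apply: ler_vnorm2 => j; rewrite [(_ *: x) j 0]mxE [z j 0]mxE ![`|_ * x j 0|]normrM.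
    rewrite ler_wpM2r // ger0_norm ?divr_ge0 // [leRHS]ger0_norm ?divr_ge0 //.
    rewrite ler_pdivlMr //.
    by have /andP[_] := CB (delta_mx j 0); rewrite -!colE; lra.
  have /andP[h _] := CB (D *m x); rewrite Dx in h.
  rewrite /normalize_cols -mulmxA; apply: le_trans h.
  have := sigma_min (normalize_cols B) z; rewrite -/s.
  have := ler_wpM2l (ltW s0) nz; lra.
have k1 := invr_sigma_le_kappa2D n0 inj; rewrite -/s in k1.
rewrite {1}/kappa2D /kappa2 -/(normalize_cols C).
move: (kappa2D B) (sigma (normalize_cols C) 0) (sigma (normalize_cols C) n.-1) k1 up lo.
move: s s0 => s s0 K a b k1 up lo.
have b0' : 0 < b by apply: lt_le_trans lo; lra.
have K0 : 0 < K by apply: lt_le_trans k1; rewrite invr_gt0.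
have Ks : 1 <= K * s by rewrite -(mulVf (lt0r_neq0 s0)) ler_wpM2r // ltW.
have n0R : 0 <= n%:R :> R by [].
rewrite ler_pdivrMr // (le_trans up) //.
have h1 := ler_wpM2l (ltW K0) lo; have h2 : n%:R * 1 <= n%:R * (4 * (K * b)).
  by rewrite ler_wpM2l //; lra.
lra.
Qed.

(** The relative size of the error of the product in precision [uh] involves
    [kappa2 A] because cancellation can make the columns of [A V] as small as
    the smallest singular value of [A] allows. *)
Lemma demoted_product_error (R : realType) m n (uh u : R) (A : 'M[R]_(m, n))
    (V : 'M[R]_n) P C j :
  (0 < n)%N -> (forall x : 'cV[R]_n, A *m x = 0 -> x = 0) ->
  0 <= uh -> n%:R * uh < 1 -> 0 <= u <= 1 -> gam n uh * kappa2 A <= u / 4 ->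
  fl_mulmx uh A V P -> fl_demote u P C ->
  vnorm2 (col j C - col j (A *m V)) <= 2 * n%:R * u * vnorm2 (col j (A *m V)).
Proof.
move=> n0 inj uh0 nuh /andP[u0 u1] gk flP flC.
have s0 := sigma_min_gt0 n0 inj.
have AVj : col j (A *m V) = A *m col j V by rewrite !colE mulmxA.
have h1 := fl_mulmx_col_error j uh0 nuh (sigma_max A) flP.
have h2 : vnorm2 (col j P - A *m col j V) <= n%:R * (u / 4) * vnorm2 (A *m col j V).
  apply: le_trans h1 _.
  have -> : gam n uh * (n%:R * sigma A 0) * vnorm2 (col j V) =
      n%:R * (gam n uh * kappa2 A) * (sigma A n.-1 * vnorm2 (col j V)).
    by rewrite /kappa2; field; rewrite gt_eqF.
  have g0 := gam_ge0 uh0 nuh.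
  have k0 : 0 <= kappa2 A by rewrite /kappa2 divr_ge0 // sigma_ge0.
  apply: ler_pM.
  - by rewrite mulr_ge0 // mulr_ge0.
  - by rewrite mulr_ge0 // sigma_ge0.
  - by rewrite ler_wpM2l.
  - exact: sigma_min.
have h3 : vnorm2 (col j C - col j P) <= u * vnorm2 (col j P).
  rewrite -[X in X * _]ger0_norm // -vnorm2Z; apply: ler_vnorm2 => i.
  have [d du CE] := flC i j; rewrite !mxE CE mulrDr mulr1 addrC addKr.
  by rewrite !normrM mulrC ler_wpM2r // (ger0_norm u0).
rewrite AVj.
have -> : col j C - A *m col j V = (col j C - col j P) + (col j P - A *m col j V).
  by rewrite addrA subrK.
rewrite (le_trans (ler_vnorm2D _ _)) //.
set a := vnorm2 (A *m col j V) in h2 *; have a0 : 0 <= a by exact: vnorm2_ge0.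
have h4 : vnorm2 (col j P) <= vnorm2 (col j P - A *m col j V) + a.
  by rewrite -{1}(subrK (A *m col j V) (col j P)) ler_vnorm2D.
have n1 : 1 <= n%:R :> R by rewrite ler1n.
have t0 : 0 <= n%:R * (u / 4) * a by rewrite !mulr_ge0 ?invr_ge0.
have h5 : u * vnorm2 (col j P) <= u * (n%:R * (u / 4) * a + a).
  by rewrite ler_wpM2l // (le_trans h4) // lerD2r.
have h6 : u * (n%:R * (u / 4) * a) <= 1 * (n%:R * (u / 4) * a) by rewrite ler_wpM2r.
have h7 : 1 * (u * a) <= n%:R * (u * a) by rewrite ler_wpM2r // mulr_ge0.
lra.
Qed.

(** * Gaps and angles *)

Lemma sigma_neq (R : realType) m n (B : 'M[R]_(m, n)) (i j : 'I_n) :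
  uniq (singular_values B) -> i != j -> sigma B i != sigma B j.
Proof. by move=> uB ij; rewrite /sigma nth_uniq ?size_singular_values. Qed.

Lemma svrg_le2 (R : realType) m n (B : 'M[R]_(m, n)) (k : 'I_n) : svrg B k <= 2.
Proof. exact: bigmin_le_id. Qed.

Lemma svrg_gap (R : realType) m n (B : 'M[R]_(m, n)) (j k : 'I_n) :
  0 < sigma B k -> j != k -> svrg B k * sigma B k <= `|sigma B k - sigma B j|.
Proof.
move=> s0 jk; rewrite -ler_pdivlMr //.
exact: (bigmin_le_cond _ (fun j : 'I_n => `|sigma B k - sigma B j| / sigma B k)).
Qed.

Lemma svrg_gt0 (R : realType) m n (B : 'M[R]_(m, n)) (k : 'I_n) :
  uniq (singular_values B) -> 0 < sigma B k -> 0 < svrg B k.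
Proof.
move=> uB s0; apply/bigmin_gtP; split=> // j jk.
by rewrite divr_gt0 // normr_gt0 subr_eq0 sigma_neq // eq_sym.
Qed.

(** Since the singular values are simple, [v] is the [k]-th column of [Q] up to
    sign, so the squared sine is the share of [|w|^2] in the other coordinates. *)
Lemma sin_angle_le (R : realType) m n (A : 'M[R]_(m, n)) Q (k : 'I_n) v w :
  singular_basis A (\row_j sigma A j) Q -> uniq (singular_values A) ->
  right_singular_vector A k v -> 0 < vnorm2 w ->
  sin (angle v w) * vnorm2 w <= \sum_(j | j != k) `|(Q^T *m w) j 0|.
Proof.
move=> sA uA [v1 [w' [_ Av Aw]]] w0; have [QQ _] := sA.
have eigv : A^T *m (A *m v) = sigma A k ^+ 2 *: v.
  by rewrite Av -scalemxAr Aw scalerA expr2.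
have c0 j : j != k -> (Q^T *m v) j 0 = 0.
  move=> jk; rewrite coordE.
  have : dot (A^T *m (A *m col j Q)) v = dot (col j Q) (A^T *m (A *m v)).
    by rewrite !dot_mulmxl !trmxK.
  rewrite (singular_basis_eigen _ sA) eigv dotZl dotZr mxE => /eqP.
  rewrite -subr_eq0 -mulrBl mulf_eq0 subr_eq0 eqrXn2 ?sigma_ge0 //.
  by rewrite (negbTE (sigma_neq uA jk)) /= => /eqP.
set y := Q^T *m w; set S := \sum_(j | _) _.
have ny : vnorm2 w ^+ 2 = y k 0 ^+ 2 + \sum_(j | j != k) y j 0 ^+ 2.
  by rewrite -(vnorm2_coord w QQ) vnorm2_sqr (bigD1 k).
have ck : (Q^T *m v) k 0 ^+ 2 = 1.
  rewrite -(expr1n _ 2) -v1 -(vnorm2_coord v QQ) vnorm2_sqr (bigD1 k) //=.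
  by rewrite big1 ?addr0 // => j /c0 ->; rewrite expr0n.
have dvw : dot v w = (Q^T *m v) k 0 * y k 0.
  rewrite -[v in LHS](mul1mx v) -(orthomxC QQ) -mulmxA dot_mulmxl dotE (bigD1 k) //=.
  by rewrite big1 ?addr0 // => j /c0 ->; rewrite mul0r.
rewrite /angle v1 mul1r -/(dot v w); set t := _ / _.
have tw : t * vnorm2 w = `|dot v w| by rewrite divfK // gt_eqF.
have tw2 : t ^+ 2 * vnorm2 w ^+ 2 = y k 0 ^+ 2.
  by rewrite -exprMn tw real_normK ?num_real // dvw exprMn ck mul1r.
have t0 : 0 <= t by rewrite divr_ge0.
have t1 : t <= 1.
  by rewrite ler_pdivrMr // mul1r (le_trans (normr_dot_le _ _)) // v1 mul1r.
have S0 : 0 <= S by apply: sumr_ge0.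
rewrite sin_acos; last by rewrite t1 andbT (le_trans _ t0) // lerN10.
have t2 : 0 <= 1 - t ^+ 2 by rewrite subr_ge0 expr_le1.
rewrite -ler_sqr ?nnegrE ?mulr_ge0 ?sqrtr_ge0 ?vnorm2_ge0 //.
rewrite exprMn sqr_sqrtr // mulrBl mul1r tw2 ny addrC addKr.
rewrite [leRHS]expr2 {1}/S mulr_suml; apply: ler_sum => j jk.
rewrite -(real_normK (num_real (y j 0))) expr2 ler_wpM2l // /S (bigD1 j) //=.
by rewrite lerDl sumr_ge0.
Qed.

Lemma full_rank_injective (R : realType) m n (A : 'M[R]_(m, n)) :
  \rank A = n -> forall x : 'cV[R]_n, A *m x = 0 -> x = 0.
Proof.
move=> rA x Ax; apply: trmx_inj; rewrite trmx0; apply/eqP.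
have fA : row_free A^T by rewrite /row_free mxrank_tr rA.
by rewrite -(mulmx_free_eq0 _ fA) -trmx_mul Ax trmx0.
Qed.

(** The departure of [V (1 + E)] from orthogonality; the products of [p] and [e]
    are absorbed into the linear terms by means of [e <= 1]. *)
Lemma gram_mul_near_id (R : realType) n (V E : 'M[R]_n) (p e : R) :
  0 <= p -> 0 <= e <= 1 ->
  opbound p (V^T *m V - 1%:M) -> opbound e E ->
  opbound (3 * e + 4 * p)
    ((V *m (1%:M + E))^T *m (V *m (1%:M + E)) - 1%:M).
Proof.
move=> p0 /andP[e0 e1] bV bE; have bET := opbound_tr e0 bE.
have -> : (V *m (1%:M + E))^T *m (V *m (1%:M + E)) - 1%:M =
    (1%:M + E)^T *m (V^T *m V - 1%:M) *m (1%:M + E) + (E^T *m E + (E^T + E)).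
  rewrite trmx_mul [(1%:M + E)^T]raddfD /= trmx1 mulmxA -(mulmxA _ V^T).
  move: (V^T *m V) => X.
  rewrite !(mulmxDl, mulmxDr, mulmxN, mulNmx) !(mul1mx, mulmx1).
  move: (E^T *m X *m E) (E^T *m X) (X *m E) (E^T *m E) => a b c d.
  by apply/matrixP => i j; rewrite !mxE; ring.
have b1E : opbound (1 + e) (1%:M + E) by apply: opboundD => //; exact: opbound1.
have e10 : 0 <= 1 + e by rewrite addr_ge0.
have b1 := opboundM (mulr_ge0 e10 p0) (opboundM e10 (opbound_tr e10 b1E) bV) b1E.
apply: opboundW (opboundD b1 (opboundD (opboundM e0 bET bE) (opboundD bET bE))).
have h1 : e * p <= 1 * p by rewrite ler_wpM2r.
have h2 : e * (e * p) <= 1 * (e * p) by rewrite ler_wpM2r // mulr_ge0.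
have h3 : e * e <= 1 * e by rewrite ler_wpM2r.
lra.
Qed.

(** * Error of the computed singular vectors *)

(** The computed vector differs from [V (1 + E) q] by the rounding error of the
    product, by the error [dV] of the singular vector computed for the
    preconditioned matrix and by the right backward error [E]. *)
Lemma computed_vector_error (R : realType) n (u e : R) (V VJ dV E W : 'M[R]_n) k :
  0 <= u -> n%:R * u <= 1 / 2 -> 0 <= e <= 1 ->
  opbound 2 V -> opbound e E -> opbound e dV ->
  vnorm2 (col k (VJ + dV)) = 1 -> fl_mulmx u V VJ W ->
  vnorm2 (col k W - V *m (1%:M + E) *m col k (VJ + dV)) <=
    8 * n%:R ^+ 2 * u + 4 * e.
Proof.
move=> u0 nu /andP[e0 e1] bV bE bdV q1 flW; set q := col k (VJ + dV) in q1 *.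
have nu1 : n%:R * u < 1 by lra.
have nu0 : 0 <= n%:R * u by rewrite mulr_ge0.
have qE : col k VJ = q - col k dV by rewrite /q raddfD addrK.
have ndV : vnorm2 (col k dV) <= e by exact: vnorm2_col_le.
have nVJ : vnorm2 (col k VJ) <= 2.
  by rewrite qE (le_trans (ler_vnorm2B _ _)) // q1; lra.
have gu : gam n u <= 2 * (n%:R * u).
  by rewrite /gam ler_pdivrMr; nra.
have h1 : vnorm2 (col k W - V *m col k VJ) <= 2 * (n%:R * u) * (n%:R * 2) * 2.
  apply: le_trans (fl_mulmx_col_error k u0 nu1 bV flW) _.
  have n2 : 0 <= n%:R * 2 :> R by rewrite mulr_ge0.
  apply: ler_pM => //; first by rewrite mulr_ge0 // gam_ge0.
  by rewrite ler_wpM2r.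
have -> : col k W - V *m (1%:M + E) *m q =
    (col k W - V *m col k VJ) - V *m (col k dV + E *m q).
  rewrite qE !(mulmxDl, mulmxDr, mulmxBr) mulmx1 !mulmxA mulmxN.
  by apply/colP => i; rewrite !mxE; ring.
have h2 : vnorm2 (V *m (col k dV + E *m q)) <= 2 * (e + e).
  rewrite (le_trans (bV _)) // ler_wpM2l // (le_trans (ler_vnorm2D _ _)) //.
  by rewrite lerD // (le_trans (bE q)) // q1 mulr1.
rewrite (le_trans (ler_vnorm2B _ _)) // (le_trans (lerD h1 h2)) //.
by rewrite le_eqVlt; apply/orP; left; apply/eqP; ring.
Qed.

(** The constant 4 is the inverse of a lower bound for [|w|], which is within
    [delta <= 1 / 4] of a vector of norm at least [1 / 2]. *)
Lemma sin_perturbed_vector (R : realType) m n (A G : 'M[R]_(m, n)) (M : 'M[R]_m)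
    (N Q' : 'M[R]_n) (s : 'rV[R]_n) (eta eps rho delta : R) (k : 'I_n) v w :
  G = M *m A *m N -> singular_basis G s Q' ->
  (forall i j : 'I_n, (i <= j)%N -> s 0 j <= s 0 i) -> (forall i, 0 <= s 0 i) ->
  0 <= eta -> 0 <= eps ->
  opbound eta (M - 1%:M) -> opbound eps (N^T *m N - 1%:M) ->
  0 < rho <= 2 -> eta + eps <= rho / 8 -> 0 < sigma A k ->
  (forall j : 'I_n, j != k -> rho * sigma A k <= `|sigma A k - sigma A j|) ->
  uniq (singular_values A) -> right_singular_vector A k v ->
  vnorm2 (w - N *m col k Q') <= delta -> delta <= 1 / 4 ->
  sin (angle v w) <= 4 * n%:R * (24 * ((eta + eps) / rho) + delta).
Proof.
move=> GE sG s_anti s_ge0 eta0 eps0 bM bN /andP[rho0 rho2] small sk0 gap uA hv hw hd.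
have [Q sA] := singular_basis_exists A; have [QQ _] := sA.
have eps1 : 0 <= eps <= 1 by rewrite eps0 /=; clear -eta0 eps0 small rho2; lra.
set q := col k Q' in hw; set x := N *m q in hw.
have q1 : vnorm2 q = 1 by rewrite /q colE vnorm2_orthomx ?vnorm2_delta //; case: sG.
have hx (j : 'I_n) : j != k -> `|(Q^T *m x) j 0| <= 24 * ((eta + eps) / rho).
  move=> jk; rewrite mulrA ler_pdivlMr // mulrC.
  apply: (perturbed_singular_vector GE sA sG) jk; rewrite ?mxE //.
  - by move=> i l il; rewrite !mxE sigma_anti // il ltn_ord.
  - by move=> i; rewrite mxE sigma_ge0.
  - by move=> l lk; rewrite !mxE; exact: gap.
have nw : 1 / 4 <= vnorm2 w.
  have /andP[nx _] := gram_bounds q eps1 bN; rewrite q1 -/x in nx.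
  have := ler_vnorm2B w (w - x); rewrite opprB addrC subrK.
  move: nx hw hd small eta0 rho2; clear; lra.
have w0 : 0 < vnorm2 w by apply: lt_le_trans nw; clear; lra.
set c := 24 * _ + delta.
have c0 : 0 <= c.
  rewrite addr_ge0 ?(le_trans _ hw) ?vnorm2_ge0 // mulr_ge0 // divr_ge0 ?addr_ge0 //.
  exact: ltW.
have sinw : sin (angle v w) * vnorm2 w <= n%:R * c.
  apply: le_trans (sin_angle_le sA uA hv w0) _.
  rewrite mulr_natl -[X in _ *+ X]card_ord -sumr_const.
  rewrite [leRHS](bigID (fun j => j != k)) /= -[leLHS]addr0; apply: lerD; last exact: sumr_ge0.
  apply: ler_sum => j jk.
  have -> : w = x + (w - x) by rewrite addrC subrK.
  rewrite mulmxDr [X in `|X|]mxE (le_trans (ler_normD _ _)) // lerD ?hx //.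
  by rewrite (le_trans (normr_coord_le _ _)) // vnorm2_coord.
have nc0 : 0 <= n%:R * c by rewrite mulr_ge0.
have h4 := ler_wpM2l nc0 nw.
have : sin (angle v w) * vnorm2 w <= 4 * n%:R * c * vnorm2 w.
  by move: sinw h4; clear; lra.
by rewrite ler_pM2r.
Qed.

Lemma near_id_mul (R : realType) n (E F : 'M[R]_n) (e f : R) :
  0 <= e -> f <= 1 -> opbound e E -> opbound f F ->
  opbound (2 * e + f) ((1%:M + E) *m (1%:M + F) - 1%:M).
Proof.
move=> e0 f1 bE bF.
have -> : (1%:M + E) *m (1%:M + F) - 1%:M = E *m (1%:M + F) + F.
  by rewrite mulmxDl mul1mx addrAC [1%:M + F]addrC addrK addrC.
apply: opboundW (opboundD (opboundM e0 bE (opboundD (@opbound1 R n) bF)) bF).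
have := ler_wpM2l e0 f1; lra.
Qed.

(** Both [(1 - p)^-1] and [kap] are at least 1, so the bound on their product with
    [6 n u] bounds [n u] alone; likewise the factors [1 - p <= 1 <= 1 + p] can be
    dropped from the bound on [gam n uh]. *)
Lemma roundoff_bounds (R : realType) (n : nat) (p u uh kap : R) :
  (0 < n)%N -> 0 <= p < 1 / 2 -> 1 <= kap -> 0 <= uh -> uh < u ->
  6 * n%:R * u * (1 - p)^-1 * kap < 1 ->
  gam n uh < (1 - p) * u / (4 * (1 + p) * kap) ->
  [/\ n%:R * u <= 1 / 6, n%:R * uh < 1, u <= 1 & gam n uh * kap <= u / 4].
Proof.
move=> n0 /andP[p0 p1] kap1 uh0 uhu c1 c2.
have u0 : 0 < u by exact: le_lt_trans uhu.
have n1 : 1 <= n%:R :> R by rewrite ler1n.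
have nu6 : n%:R * u <= 1 / 6.
  have q0 : 0 < 1 - p by lra.
  have h1 : 1 <= (1 - p)^-1 * kap by rewrite ler_pdivlMl // mulr1; lra.
  have h0 : 0 <= 6 * (n%:R * u) by rewrite mulr_ge0 // mulr_ge0 // ltW.
  have h2 := ler_wpM2l h0 h1; rewrite mulr1 in h2.
  have h3 : 6 * (n%:R * u) < 1 by apply: le_lt_trans h2 _; rewrite !mulrA.
  lra.
have nuh : n%:R * uh < 1.
  by apply: le_lt_trans (ler_wpM2l (ler0n R n) (ltW uhu)) _; lra.
split=> //; first by have := ler_wpM2r (ltW u0) n1; lra.
have g0 := gam_ge0 uh0 nuh.
have q0 : 0 < 4 * (1 + p) * kap by rewrite mulr_gt0 //; lra.
move: c2; rewrite ltr_pdivlMr //.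
have h1 : 0 <= gam n uh * kap * p by rewrite mulr_ge0 // mulr_ge0 //; lra.
have h2 : 0 <= p * u by rewrite mulr_ge0 // ltW.
lra.
Qed.

Theorem theorem2p3 (R : realType) (m n : nat) (p1 p2 : R) (hmn : (n <= m)%N) :
  exists p4 : R,
  forall (uh u : R) (A : 'M[R]_(m, n)) (V : 'M[R]_n)
    (Acomp : 'M[R]_(m, n)) (W : 'M[R]_n),
  let p3 := Num.max (6 * p2 + 3 * Num.sqrt (m * n)%N%:R)
                    (p1 + p2 + p1 * p2 * u) in
  0 < uh -> uh < u ->
  \rank A = n ->
  opnorm2 (V^T *m V - 1%:M) <= p1 * u -> p1 * u < 1 / 2 ->
  mp_jacobi_run p2 uh u A V Acomp W ->
  gam n uh < gam n u -> gam n u < 1 ->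
  6 * n%:R * u * (1 - p1 * u)^-1 * kappa2 A < 1 ->
  gam n uh < (1 - p1 * u) * u / (4 * (1 + p1 * u) * kappa2 A) ->
  4 * Num.sqrt m%:R * u < 1 ->
  16 * m%:R * Num.sqrt n%:R * u * kappa2D (A *m V) < 1 ->
  uniq (singular_values A) ->
  uniq (singular_values (A *m V)) ->
  uniq (singular_values Acomp) ->
  p3 * u * kappa2D (A *m V) <=
    Num.min (1 / 6) (\big[Num.min/(1 / 6)]_(k < n) (svrg A k / 6)) ->
  forall (k : 'I_n) (v : 'cV[R]_n),
  right_singular_vector A k v ->
  sin (angle v (col k W)) <= p4 * u * (1 + kappa2D (A *m V) / svrg A k).
Proof.
(* [K u kappa2D (A V)] bounds the sum of the departures of the left factor [M]
   and of the Gram matrix of the right factor [N] from the identity. *)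
pose K := 8 * n%:R * p2 + 2 * n%:R ^+ 2 + 3 * p2 + 4 * p1.
exists (96 * n%:R * K) => uh u A V C W p3 uh0 uhu rA normV p1u run _ _ c1 c2.
move=> _ _ uA _ _ _ k v hv.
have u0 : 0 < u by exact: lt_trans uhu.
have n0 : (0 < n)%N := leq_ltn_trans (leq0n k) (ltn_ord k).
have n1 : 1 <= n%:R :> R by rewrite ler1n.
have injA := full_rank_injective rA.
have bV := opbound_opnorm2 normV.
have p1u0 : 0 <= p1 * u := opnorm2_ge0 normV n0.
have p10 : 0 <= p1 by rewrite -(pmulr_lge0 _ u0).
case: run => P [U [s [VJ [flP flC [s_ge0 s_anti jac] flW]]]].
case: jac => EL [ER [dU [dV [Csvd [UU VV] nEL [nER ndU ndV]]]]].
have p20 : 0 <= p2 by rewrite -(pmulr_lge0 _ u0) (opnorm2_ge0 nER n0).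
have [uV _] : V \in unitmx /\ opbound (1 - p1 * u)^-1 (invmx V).
  by apply: gram_unitmx => //; rewrite p1u0; move: p1u; clear; lra.
have injAV (x : 'cV[R]_n) : A *m V *m x = 0 -> x = 0.
  by rewrite -mulmxA => /injA Vx; rewrite -(mulKmx uV x) Vx mulmx0.
have [kD kDE] : exists x, x = kappa2D (A *m V) by eexists.
rewrite -kDE; set rho := svrg A k.
have sk0 : 0 < sigma A k.
  apply: lt_le_trans (sigma_min_gt0 n0 injA) _.
  by rewrite sigma_anti // -ltnS prednK // ltn_ord /=.
have rho0 : 0 < rho by exact: svrg_gt0.
have rho2 : rho <= 2 by exact: svrg_le2.
have kD1 : 1 <= kD by rewrite kDE; apply: kappa2_ge1 n0 (normalize_cols_injective injAV).
have kA1 : 1 <= kappa2 A by exact: kappa2_ge1.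
have nK0 : 0 <= n%:R * p2 by rewrite mulr_ge0.
have K0 : 0 <= K by rewrite /K !addr_ge0 // ?mulr_ge0 ?exprn_ge0.
have ukD0 : 0 <= u * kD by rewrite mulr_ge0 ?ltW // (lt_le_trans ltr01).
have ukD : u <= u * kD by rewrite ler_peMr // ltW.
have Ku0 : 0 <= K * u by rewrite mulr_ge0 // ltW.
set t := kD / rho; have tE : t * rho = kD by rewrite divfK // gt_eqF.
have t0 : 0 <= t by rewrite divr_ge0 // ltW // (lt_le_trans ltr01).
clearbody t.
have nKut : 1 * (K * u * t) <= n%:R * (K * u * t) by rewrite ler_wpM2r // mulr_ge0.
have nKu0 : 0 <= n%:R * (K * u) by rewrite mulr_ge0.
have [big|small] := leP rho (32 * (K * (u * kD))).
  (* The gap is at most 32 times the perturbation: the claimed bound is at least 1. *)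
  apply: le_trans (sin_le1 _) _.
  have : 1 <= 32 * (K * u * t).
    by rewrite -(ler_pM2r rho0) mul1r -!mulrA tE.
  by move: nKut nKu0; clear; lra.
have p1u01 : 0 <= p1 * u < 1 / 2 by rewrite p1u0.
have [nu6 nuh u1 guh] := roundoff_bounds n0 p1u01 kA1 (ltW uh0) uhu c1 c2.
(* The rounding errors of the product act as a left factor [1 + E1]. *)
have hcol j : vnorm2 (col j C - col j (A *m V)) <=
    2 * n%:R * u * vnorm2 (col j (A *m V)).
  by apply: demoted_product_error guh flP flC => //; rewrite ?(ltW u0) ?(ltW uh0).
have c0 : 0 <= 2 * n%:R * u by rewrite mulr_ge0 // ?mulr_ge0 // ltW.
have [E1 CE bE1] := columnwise_perturbation n0 injAV c0 hcol.
rewrite -kDE in bE1.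
pose e1 := 2 * n%:R ^+ 2 * (u * kD).
have {}bE1 : opbound e1 E1.
  by apply: opboundW bE1; rewrite le_eqVlt; apply/orP; left; apply/eqP; rewrite /e1; ring.
pose el := 4 * (n%:R * p2) * (u * kD).
pose eta := 2 * el + e1.
pose eps := 3 * (p2 * u) + 4 * (p1 * u).
have e10 : 0 <= e1 by rewrite mulr_ge0 // mulr_ge0 ?exprn_ge0.
have el0 : 0 <= el by rewrite mulr_ge0 // mulr_ge0.
have p2u0 : 0 <= p2 * u by rewrite mulr_ge0 // ltW.
have eps0 : 0 <= eps by rewrite addr_ge0 // mulr_ge0.
have eta0 : 0 <= eta by rewrite addr_ge0 // mulr_ge0.
have sumK : eta + eps <= K * (u * kD).
  have h1 := ler_wpM2l p10 ukD; have h2 := ler_wpM2l p20 ukD.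
  have -> : K * (u * kD) = eta + (3 * (p2 * (u * kD)) + 4 * (p1 * (u * kD))).
    by rewrite /K /eta /el /e1; ring.
  by move: h1 h2; rewrite lerD2l /eps; clear; lra.
have e12 : e1 <= 1 / 2 by move: sumK small el0 eps0 rho2; clear; rewrite /eta; lra.
have p2u1 : p2 * u <= 1 by move: sumK small eta0 p1u0 p2u0 rho2; clear; rewrite /eps; lra.
have p2u01 : 0 <= p2 * u <= 1 by rewrite p2u0.
have bEL : opbound el EL.
  apply: opboundW (opbound_opnorm2 nEL).
  have := kappa2D_perturbed n0 injAV (opboundW e12 bE1); rewrite -CE -kDE.
  move/(ler_wpM2l p2u0)/le_trans; apply.
  by rewrite le_eqVlt; apply/orP; left; apply/eqP; rewrite /el; ring.
(* The backward error of the Jacobi step supplies the other factors: the exact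
   singular value decomposition is that of [M A N]. *)
pose M : 'M[R]_m := (1%:M + EL) *m (1%:M + E1).
pose N : 'M[R]_n := V *m (1%:M + ER).
have bM : opbound eta (M - 1%:M).
  by apply: near_id_mul => //; apply: le_trans e12 _; clear; lra.
have bN : opbound eps (N^T *m N - 1%:M).
  exact: gram_mul_near_id p1u0 p2u01 bV (opbound_opnorm2 nER).
pose QV := VJ + dV.
pose G := (U + dU) *m diag_mx s *m QV^T.
have GE : G = M *m A *m N by rewrite /G -Csvd CE /M /N !mulmxA.
have sG : singular_basis G s QV := singular_basis_svd s UU VV.
have small8 : eta + eps <= rho / 8 by move: sumK small rho0; clear; lra.
have q1 : vnorm2 (col k QV) = 1 by rewrite colE vnorm2_orthomx ?vnorm2_delta.
have hw : vnorm2 (col k W - N *m col k QV) <= 4 * (K * u).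
  have bV2 : opbound 2 V.
    have p1u1 : 0 <= p1 * u <= 1 by rewrite p1u0 (le_trans (ltW p1u)) //; clear; lra.
    move=> y; have /andP[_ h] := gram_bounds y p1u1 bV; apply: le_trans h _.
    by rewrite ler_wpM2r ?vnorm2_ge0 //; move: p1u; clear; lra.
  have nu2 : n%:R * u <= 1 / 2 by move: nu6; clear; lra.
  apply: le_trans (computed_vector_error (ltW u0) nu2 p2u01 bV2
    (opbound_opnorm2 nER) (opbound_opnorm2 ndV) q1 flW) _.
  have -> : 4 * (K * u) = 8 * n%:R ^+ 2 * u + 4 * (p2 * u) +
      (32 * (n%:R * p2) * u + 8 * (p2 * u) + 16 * (p1 * u)).
    by rewrite /K; ring.
  by rewrite lerDl !addr_ge0 // mulr_ge0 // ?mulr_ge0 // ltW.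
have Ku16 : 4 * (K * u) <= 1 / 4.
  by have := ler_wpM2l K0 ukD; move: small rho2; clear; lra.
have rho02 : 0 < rho <= 2 by rewrite rho0.
have gap (j : 'I_n) : j != k -> rho * sigma A k <= `|sigma A k - sigma A j|.
  exact: svrg_gap.
apply: le_trans (sin_perturbed_vector GE sG s_anti s_ge0 eta0 eps0 bM bN rho02
  small8 sk0 gap uA hv hw Ku16) _.
have h1 : (eta + eps) / rho <= K * u * t.
  rewrite ler_pdivrMr //.
  by have -> : K * u * t * rho = K * (u * kD) by rewrite -tE; ring.
have h2 := ler_wpM2l (ler0n R n) h1.
move: h2 nKu0; clear; lra.
Qed.
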